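(* Let $q\in L^1_{\mathrm{loc}}(\mathbb R)$ with $\rho(D(q))\neq\emptyset$, and let $z_1\in\rho(D(q))$ (then necessarily $z_1\in\mathbb C\setminus\mathbb R$). Let $q^{(1)}_{z_1}$ be the potential constructed from $z_1$ and the Weyl–Titchmarsh-type solutions $\Psi_\pm(z_1,\cdot)$ as described in the context. Then $$\sigma\big(D(q^{(1)}_{z_1})\big)=\sigma(D(q))\cup\{z_1,\overline{z_1}\},\quad \sigma_{\mathrm p}\big(D(q^{(1)}_{z_1})\big)=\sigma_{\mathrm p}(D(q))\cup\{z_1,\overline{z_1}\},\quad \sigma_{\mathrm e}\big(D(q^{(1)}_{z_1})\big)=\sigma_{\mathrm e}(D(q)).$$
   Context: Let $q\in L^1_{\mathrm{loc}}(\mathbb R)$. For $z\in\mathbb C$, a $z$-wave function associated with $q$ is a function $\Psi(z,\cdot)=(\psi_1(z,\cdot),\psi_2(z,\cdot))^\top\in AC_{\mathrm{loc}}(\mathbb R)^2$, not identically zero, with $\psi_1'=-iz\psi_1+q\psi_2$, $\psi_2'=iz\psi_2-\overline{q}\psi_1$ a.e.; equivalently $M(q)\Psi=z\Psi$ with $M(q)=i\begin{pmatrix}\frac{d}{dx}&-q\\-\overline q&-\frac{d}{dx}\end{pmatrix}$. $D(q)$ is the maximal operator in $L^2(\mathbb R)^2$: $D(q)F=M(q)F$ on $\{F\in L^2(\mathbb R)^2: F\in AC_{\mathrm{loc}}(\mathbb R)^2,\ M(q)F\in L^2(\mathbb R)^2\}$. $\mathcal C$ denotes componentwise complex conjugation,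 $\sigma_1=\begin{pmatrix}0&1\\1&0\end{pmatrix}$, $\sigma_4=\begin{pmatrix}0&1\\-1&0\end{pmatrix}$, $\mathcal J=\sigma_1\mathcal C$, $\mathcal K=\sigma_4\mathcal C$, so $\mathcal K(a,b)^\top=(\overline b,-\overline a)^\top$. For $z_1\in\rho(D(q))$ there exist $z_1$-wave functions $\Psi_-(z_1,\cdot)$, $\Psi_+(z_1,\cdot)$, unique up to constant multiples and linearly independent, with $\Psi_-(z_1,\cdot)\in L^2((-\infty,R])^2$ and $\Psi_+(z_1,\cdot)\in L^2([R,\infty))^2$ for all $R\in\mathbb R$; fix such a choice and put $\Psi(z_1,x)=\Psi_-(z_1,x)+\Psi_+(z_1,x)=(\psi_1(z_1,x),\psi_2(z_1,x))^\top$ and $$q^{(1)}_{z_1}(x)=q(x)+4\,\mathrm{Im}(z_1)\,\psi_1(z_1,x)\overline{\psi_2(z_1,x)}\,\|\Psi(z_1,x)\|_{\mathbb C^2}^{-2}$$ (which lies in $L^1_{\mathrm{loc}}(\mathbb R)$). For a densely defined closed operator $S$ in a Hilbert space: $\sigma(S)$ is the spectrum, $\sigma_{\mathrm p}(S)$ the set of eigenvalues, and $\sigma_{\mathrm e}(S)$ the set of $\lambda\in\mathbb C$ for which there is a sequence $\{f_n\}\subset\mathrm{dom}(S)$ with $\|f_n\|=1$, having no convergent subsequence, and $\|(S-\lambda)f_n\|\to0$. *)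

(* Defs.v *)
From HB Require Import structures.
From mathcomp Require Import all_boot all_order all_algebra.
From mathcomp Require Import complex.
From mathcomp Require Import all_classical all_reals all_analysis.
Set Implicit Arguments. Unset Strict Implicit. Unset Printing Implicit Defensive.
Import Order.TTheory GRing.Theory Num.Theory.
Local Open Scope classical_set_scope.
Local Open Scope ring_scope.

Section Dirac.
Variable R : realType.
Local Notation C := (R[i]).
Local Notation mu := (@lebesgue_measure R).

Definition reP (f : R -> C) : R -> R := fun x => complex.Re (f x).
Definition imP (f : R -> C) : R -> R := fun x => complex.Im (f x).
Definition cconj (z : C) : C := Complex (complex.Re z) (- complex.Im z).
Definition csq (z : C) : R := complex.Re z ^+ 2 + complex.Im z ^+ 2.

Definition vfun := R -> C * C.
Definition vsq (F : vfun) (x : R) : R := csq (F x).1 + csq (F x).2.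
Definition vadd (F G : vfun) : vfun := fun x => ((F x).1 + (G x).1, (F x).2 + (G x).2).
Definition vsub (F G : vfun) : vfun := fun x => ((F x).1 - (G x).1, (F x).2 - (G x).2).
Definition vscale (z : C) (F : vfun) : vfun := fun x => (z * (F x).1, z * (F x).2).

Definition cmeas (D : set R) (f : R -> C) :=
  measurable_fun D (reP f) /\ measurable_fun D (imP f).

Definition L1loc (q : R -> C) :=
  cmeas setT q /\
  forall a b : R, mu.-integrable `[a, b] (fun x => (reP q x)%:E) /\
                  mu.-integrable `[a, b] (fun x => (imP q x)%:E).

Definition L2on (D : set R) (F : vfun) :=
  cmeas D (fun x => (F x).1) /\ cmeas D (fun x => (F x).2) /\
  (\int[mu]_(x in D) (vsq F x)%:E < +oo)%E.
Definition L2 (F : vfun) := L2on setT F.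
Definition l2norm (F : vfun) : R := Num.sqrt (fine (\int[mu]_x (vsq F x)%:E)).

Definition abs_cont (f : R -> R) (a b : R) :=
  forall e : R, 0 < e -> exists2 d : R, 0 < d &
    forall (n : nat) (u v : 'I_n -> R),
      (forall k, a <= u k /\ u k <= v k /\ v k <= b) ->
      (forall k l, k != l -> v k <= u l \/ v l <= u k) ->
      \sum_(k < n) (v k - u k) < d ->
      \sum_(k < n) `|f (v k) - f (u k)| < e.
Definition cACloc (f : R -> C) :=
  forall a b : R, a <= b -> abs_cont (reP f) a b /\ abs_cont (imP f) a b.
Definition ACloc (F : vfun) := cACloc (fun x => (F x).1) /\ cACloc (fun x => (F x).2).

Definition cderivable (f : R -> C) (x : R) :=
  derivable (reP f) x 1 /\ derivable (imP f) x 1.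
Definition cderiv (f : R -> C) (x : R) : C :=
  Complex (derive1 (reP f) x) (derive1 (imP f) x).

(* M(q)F = G almost everywhere, with M(q) = i [[d/dx, -q], [-conj q, -d/dx]] *)
Definition Mrel (q : R -> C) (F G : vfun) :=
  {ae mu, forall x,
     cderivable (fun y => (F y).1) x /\ cderivable (fun y => (F y).2) x /\
     'i * (cderiv (fun y => (F y).1) x - q x * (F x).2) = (G x).1 /\
     'i * (- cconj (q x) * (F x).1 - cderiv (fun y => (F y).2) x) = (G x).2}.

Definition domD (q : R -> C) (F : vfun) :=
  L2 F /\ ACloc F /\ exists G, L2 G /\ Mrel q F G.

Definition DzEq (q : R -> C) (z : C) (F G : vfun) :=
  domD q F /\ L2 G /\ Mrel q F (vadd G (vscale z F)).

Definition resolvent (q : R -> C) : set C := fun z =>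
  (forall G, L2 G -> exists F, DzEq q z F G) /\
  exists c : R, forall F G, DzEq q z F G -> l2norm F <= c * l2norm G.

Definition spectrum (q : R -> C) : set C := ~` resolvent q.

Definition point_spectrum (q : R -> C) : set C := fun z =>
  exists F, domD q F /\ l2norm F != 0 /\ Mrel q F (vscale z F).

Definition ess_spectrum (q : R -> C) : set C := fun z =>
  exists (f g : nat -> vfun),
    (forall n, DzEq q z (f n) (g n) /\ l2norm (f n) = 1) /\
    ~ (exists phi : nat -> nat, {homo phi : m n / (m < n)%N >-> (m < n)%N} /\
         exists h, L2 h /\ (fun n => l2norm (vsub (f (phi n)) h)) @ \oo --> 0) /\
    (fun n => l2norm (g n)) @ \oo --> 0.

Definition wave (q : R -> C) (z : C) (Psi : vfun) :=
  ACloc Psi /\ (exists x, Psi x != (0, 0)) /\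
  {ae mu, forall x,
     cderivable (fun y => (Psi y).1) x /\ cderivable (fun y => (Psi y).2) x /\
     cderiv (fun y => (Psi y).1) x = - 'i * z * (Psi x).1 + q x * (Psi x).2 /\
     cderiv (fun y => (Psi y).2) x = 'i * z * (Psi x).2 - cconj (q x) * (Psi x).1}.

Definition q1 (q : R -> C) (z1 : C) (Pm Pp : vfun) : R -> C := fun x =>
  let P := vadd Pm Pp x in
  q x + (4 * complex.Im z1)%:C%C * P.1 * cconj P.2 / (csq P.1 + csq P.2)%:C%C.

End Dirac.

(* Main.v *)
(* Let P(x) be the orthogonal projection onto Psi(x) = Psi_-(x) + Psi_+(x) and
   S = sigma_3 P sigma_3.  For z outside {z1, conj z1} the matrix
   T = (z - conj z1) - (z1 - conj z1) P is bounded and locally absolutely continuous,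
   and so is its inverse; it satisfies
     (M(q') - z) T = (sigma_3 T sigma_3) (M(q) - z)
   for the new potential q', so D(q) - z and D(q') - z have the same spectral
   properties.  At z1 the function phi = K Psi / |Psi|^2 is an eigenfunction of D(q'):
   it is square integrable because the Wronskian of Psi_- and Psi_+ is a nonzero
   constant, whence 1/|Psi| <= C |Psi_-| and 1/|Psi| <= C |Psi_+|.  Finally z1 is not in
   the essential spectrum of D(q'), since the resolvent of D(q) at z1 inverts D(q') - z1
   boundedly up to multiples of phi; conj z1 follows by the symmetry K. *)
Require Import Defs.
From HB Require Import structures.
From mathcomp Require Import all_boot all_order all_algebra.
From mathcomp Require Import complex ring lra.
From mathcomp Require Import all_classical all_reals all_analysis.
From mathcomp Require Import measurable_realfun.
Set Implicit Arguments. Unset Strict Implicit. Unset Printing Implicit Defensive.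
Import Order.TTheory GRing.Theory Num.Theory.
Import numFieldNormedType.Exports.
Local Open Scope classical_set_scope.
Local Open Scope ring_scope.

(** * Locally absolutely continuous functions *)

(** The matrix [T] equals [z - z1] on the line of Psi and [z - conj z1] on its orthogonal
    complement, so it degenerates exactly at the two points that become eigenvalues. The new
    potential is forced: conjugation by sigma_3 flips the off-diagonal entries of [P], hence [S - P]
    is off-diagonal and [(z1 - conj z1) (S - P)] is a mere change of potential. The sum of Psi_- and
    Psi_+ is taken because its Wronskian with either summand is the same constant up to sign,
    nonzero since [z1] is not an eigenvalue of D(q). Two obstacles shape the rest. The equations
    hold only almost everywhere and absolute continuity is the epsilon-delta notion, so constancy of
    Wronskians and uniqueness of solutions both go back to one fact: a locally absolutely continuous
    function with a.e. nonpositive derivative is nonincreasing. And [z1] is an eigenvalue of D(q'),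
    so no resolvent is available there; instead, bounded sequences with [(D(q') - z1) f_n -> 0] are
    shown to have convergent subsequences. *)

Section RealAC.
Variable R : realType.
Local Notation mu := (@lebesgue_measure R).
Implicit Types (f g h : R -> R) (a b x y : R).

Definition acloc f := forall a b, a <= b -> abs_cont f a b.

(** One epsilon-delta computation serves all closure properties: for Lipschitz functions, sums,
    products and inverses only an increment estimate remains. Two dominating functions are allowed
    because the increment of a product involves both factors. *)
Lemma abs_cont_dominated (L : R) f1 f2 g a b :
  (forall u v, a <= u -> u <= v -> v <= b ->
    `|g v - g u| <= L * (`|f1 v - f1 u| + `|f2 v - f2 u|)) ->
  abs_cont f1 a b -> abs_cont f2 a b -> abs_cont g a b.
Proof.
move=> gL ac1 ac2 e e0; set K := `|L| + 1.
have K0 : 0 < K by rewrite /K ltr_wpDl.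
have e20 : 0 < e / (2 * K) by rewrite divr_gt0 ?mulr_gt0.
have [d1 d10 h1] := ac1 _ e20; have [d2 d20 h2] := ac2 _ e20.
exists (Num.min d1 d2) => [|n u v uv disj]; first by rewrite lt_min d10.
rewrite lt_min => /andP[/(h1 n u v uv disj) {}h1 /(h2 n u v uv disj) {}h2].
apply: (@le_lt_trans _ _
  (\sum_(k < n) K * (`|f1 (v k) - f1 (u k)| + `|f2 (v k) - f2 (u k)|))).
  apply: ler_sum => k _; have [? [? ?]] := uv k.
  apply: le_trans (gL _ _ _ _ _) _ => //; apply: ler_wpM2r.
    by rewrite addr_ge0.
  by rewrite /K (le_trans (ler_norm _)) ?lerDl.
rewrite -mulr_sumr big_split/= mulrC -ltr_pdivlMr//.
have -> : e / K = e / (2 * K) + e / (2 * K) by field; rewrite gt_eqF.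
exact: ltrD.
Qed.

Lemma abs_cont_id a b : abs_cont (id : R -> R) a b.
Proof.
move=> e e0; exists e => // n u v uv _ lt; apply: le_lt_trans lt.
by apply: ler_sum => k _; rewrite ger0_norm ?subr_ge0//; have [_ []] := uv k.
Qed.

Lemma acloc_continuous f : acloc f -> continuous f.
Proof.
move=> acf x; apply/cvgrPdist_lt => e e0.
have [|d d0 h] := acf (x - 1) (x + 1) _ _ e0; first lra.
have step u v : x - 1 <= u -> u <= v -> v <= x + 1 -> v - u < d ->
    `|f v - f u| < e.
  move=> xu uv vx vud.
  have := h 1%N (fun=> u) (fun=> v).
  rewrite !big_ord1; apply => // k l; by rewrite !ord1 eqxx.
near=> y.
have dxy : `|x - y| < d by near: y; exact: cvgr_dist_lt.
have dxy1 : `|x - y| < 1 by near: y; exact: cvgr_dist_lt.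
move: dxy dxy1; rewrite 2!ltr_norml => /andP[? ?] /andP[? ?].
have [xy|yx] := leP x y.
  rewrite distrC; apply: step; lra.
apply: step; lra.
Unshelve. all: by end_near. Qed.

Lemma continuous_bounded_itv f a b : a <= b -> continuous f ->
  exists2 M : R, 0 <= M & forall x, a <= x -> x <= b -> `|f x| <= M.
Proof.
move=> ab cf; have [|c _ hc] := @EVT_max R (fun x => `|f x|) a b ab.
  apply: continuous_subspaceT => x; apply: continuous_comp; first exact: cf.
  exact: norm_continuous.
exists `|f c| => // x ax xb; apply: hc; by rewrite in_itv/= ax.
Qed.

Lemma aclocP f g : acloc f -> (forall x, g x = f x) -> acloc g.
Proof. by move=> acf e; have -> : g = f by apply/funext. Qed.

Lemma acloc_lipschitz g :
  (forall a b, a <= b -> exists L, forall u v, a <= u -> u <= v -> v <= b ->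
    `|g v - g u| <= L * (v - u)) -> acloc g.
Proof.
move=> gL a b ab; have [L hL] := gL a b ab.
apply: (@abs_cont_dominated `|L| id id) => //; try exact: abs_cont_id.
move=> u v au uv vb; apply: le_trans (hL _ _ au uv vb) _ => /=.
rewrite (ger0_norm (_ : 0 <= v - u)) ?subr_ge0//.
have := ler_norm L; have := normr_ge0 L; move: uv; rewrite -subr_ge0; nra.
Qed.

Lemma acloc_cst c : acloc (cst c).
Proof.
by apply: acloc_lipschitz => a b ab; exists 0 => *; rewrite /= subrr normr0 mul0r.
Qed.

Lemma aclocD f g : acloc f -> acloc g -> acloc (fun x => f x + g x).
Proof.
move=> acf acg a b ab; apply: (@abs_cont_dominated 1 f g); [|exact: acf|exact: acg].
move=> u v _ _ _; rewrite mul1r; apply: le_trans (ler_normD _ _).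
by rewrite opprD addrACA.
Qed.

Lemma aclocM f g : acloc f -> acloc g -> acloc (fun x => f x * g x).
Proof.
move=> acf acg a b ab.
have [M M0 hM] := continuous_bounded_itv ab (acloc_continuous acf).
have [N N0 hN] := continuous_bounded_itv ab (acloc_continuous acg).
apply: (@abs_cont_dominated (M + N) f g); [|exact: acf|exact: acg].
move=> u v au uv vb.
have -> : f v * g v - f u * g u = (f v - f u) * g v + f u * (g v - g u) by ring.
apply: le_trans (ler_normD _ _) _; rewrite !normrM.
have := hM u au (le_trans uv vb); have := hN v (le_trans au uv) vb.
have := normr_ge0 (f v - f u); have := normr_ge0 (g v - g u); nra.
Qed.

Lemma aclocN f : acloc f -> acloc (fun x => - f x).
Proof.
move=> acf; apply: aclocP (aclocM (acloc_cst (-1)) acf) _ => x.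
by rewrite mulN1r.
Qed.

Lemma aclocV f : (forall x, f x != 0) -> acloc f -> acloc (fun x => (f x)^-1).
Proof.
move=> f0 acf a b ab; have cf := acloc_continuous acf.
have [|M M0 hM] := @continuous_bounded_itv (fun x => (f x)^-1) a b ab.
  by move=> x; apply: cvgV; [exact: f0|exact: cf].
apply: (@abs_cont_dominated (M ^+ 2) f f); try exact: acf.
move=> u v au uv vb.
have -> : (f v)^-1 - (f u)^-1 = ((f u)^-1 * (f v)^-1) * - (f v - f u).
  by field; rewrite !f0.
rewrite 2!normrM normrN expr2.
have := hM u au (le_trans uv vb); have := hM v (le_trans au uv) vb.
have := normr_ge0 (f u)^-1; have := normr_ge0 (f v)^-1.
have := normr_ge0 (f v - f u).
set A := `|_ - _|; set B := `|_|; set D := `|_| => *.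
have : D * B <= M * M by apply: ler_pM.
have : 0 <= D * B by apply: mulr_ge0.
nra.
Qed.

Lemma acloc_expR (k : R) : acloc (fun x => expR (k * x)).
Proof.
apply: acloc_lipschitz => a b ab.
have df x : is_derive x 1 (fun x => expR (k * x)) (k * expR (k * x)).
  by apply: is_derive_eq; rewrite /GRing.scale/=; ring.
have cf : continuous (fun x => expR (k * x)).
  move=> x; apply: differentiable_continuous; apply/derivable1_diffP.
  by have [] := df x.
have [M M0 hM] := continuous_bounded_itv ab cf.
exists (`|k| * M) => u v au uv vb.
have [|c + ->] := MVT_segment uv (fun x _ => df x).
  exact: continuous_subspaceT.
rewrite in_itv/= => /andP[uc cv]; rewrite !normrM (ger0_norm (_ : 0 <= v - u)) ?subr_ge0//.
apply: ler_wpM2r; first by rewrite subr_ge0.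
by apply: ler_wpM2l => //; apply: hM; [exact: le_trans uc|exact: le_trans vb].
Qed.

End RealAC.

(** * Monotonicity from the sign of an almost everywhere derivative *)

Section Monotone.
Variable R : realType.
Local Notation mu := (@lebesgue_measure R).
Implicit Types (f g h : R -> R) (a b x y : R).

Lemma ae_imp (P Q : R -> Prop) : (forall x, P x -> Q x) ->
  {ae mu, forall x, P x} -> {ae mu, forall x, Q x}.
Proof.
by move=> PQ; apply: filterS; first exact: (ae_filter_ringOfSetsType mu).
Qed.

Lemma ae_imp2 (P Q S : R -> Prop) : (forall x, P x -> Q x -> S x) ->
  {ae mu, forall x, P x} -> {ae mu, forall x, Q x} -> {ae mu, forall x, S x}.
Proof.
by move=> PQS; apply: filterS2; first exact: (ae_filter_ringOfSetsType mu).
Qed.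

Lemma negligible_open_cover (N : set R) (d : R) : mu.-negligible N -> 0 < d ->
  exists U : set R, [/\ open U, N `<=` U & (mu U < d%:E)%E].
Proof.
move=> [A [mA muA0 NA]] d0; have muA : mu A = 0%E := muA0.
have [|U [oU AU muU]] := lebesgue_regularity_outer mA _ d0.
  by rewrite [ltLHS]muA.
exists U; split => //; first exact: subset_trans AU.
have mU : measurable U by exact: open_measurable.
have -> : U = A `|` (U `\` A) by rewrite setDUK.
rewrite measureU//; last by rewrite setDIK.
- by rewrite [X in (X + _)%E]muA add0e.
- exact: measurableD.
Qed.

Section growth_along_tagged_partition.
Variables (f : R -> R) (a b eps : R) (U : set R).
Hypotheses (oU : open U) (eps0 : 0 < eps).

(** Bookkeeping of the growth of [f]: slope [eps] is allowed everywhere, and any excess is charged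
    to finitely many ordered intervals. Only their total length is compared with [U]; the half-open
    []a, x]] makes that measure additive when an interval is appended. *)
Definition chain_to x := a <= x /\ x <= b /\
  exists (n : nat) (u v : nat -> R),
  [/\ forall k, (k < n)%N -> a <= u k /\ u k <= v k /\ v k <= x,
      forall k l, (k < l)%N -> (l < n)%N -> v k <= u l,
      ((\sum_(k < n) (v k - u k))%:E <= mu (U `&` `]a, x]))%E &
      f x - f a <= eps * (x - a) + \sum_(k < n) `|f (v k) - f (u k)|].

Lemma chain_to_start : a <= b -> chain_to a.
Proof.
move=> ab; split => //; split => //.
exists 0%N, (fun=> a), (fun=> a); split => //; rewrite ?big_ord0 ?measure_ge0//.
by rewrite !subrr mulr0 addr0.
Qed.

Lemma measurable_cap_itv x : measurable (U `&` `]a, x]).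
Proof. by apply: measurableI => //; exact: open_measurable. Qed.

Lemma chain_to_slope x y : chain_to x -> x <= y -> y <= b ->
  f y - f x <= eps * (y - x) -> chain_to y.
Proof.
move=> [ax [xb [n [u [v [h1 h2 h3 h4]]]]]] xy yb fxy.
split; first exact: le_trans xy. split => //; exists n, u, v; split => //.
- by move=> k /h1[? [? ?]]; do !split => //; apply: le_trans xy.
- apply: (le_trans h3); apply: le_measure; rewrite ?inE; try exact: measurable_cap_itv.
  by apply: setIS => z /=; rewrite !in_itv/= => /andP[-> /le_trans]; exact.
- move: h4 fxy; set S := \sum_(_ < _) _; lra.
Qed.

Lemma chain_to_cover x y : chain_to x -> x <= y -> y <= b ->
  `[x, y] `<=` U -> chain_to y.
Proof.
move=> [ax [xb [n [u [v [h1 h2 h3 h4]]]]]] xy yb xyU.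
split; first exact: le_trans xy. split => //.
(* The old intervals keep the indices below [n], and [[x, y]] gets index [n]. *)
exists n.+1, (fun k => if k == n then x else u k),
  (fun k => if k == n then y else v k); split => //.
- move=> k; rewrite ltnS leq_eqVlt; case: eqVneq => [->//|kn /= /h1[? [? ?]]].
  by do !split => //; apply: le_trans xy.
- move=> k l kl; rewrite ltnS leq_eqVlt => /orP[/eqP ln|ln].
    by rewrite ln eqxx ltn_eqF -?ln//; have [|_ []] := h1 k; rewrite -?ln.
  by rewrite !ltn_eqF//; [exact: h2|exact: ltn_trans ln].
- rewrite big_ord_recr/= eqxx.
  under eq_bigr do rewrite ltn_eqF//.
  rewrite EFinD; apply: (@le_trans _ _ (mu (U `&` `]a, x]) + mu `]x, y])%E).
    apply: leeD => //; rewrite lebesgue_measure_itv/= lte_fin.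
    by case: ltP => // yx; rewrite lee_fin subr_le0.
  rewrite -measureU//; last 2 first.
  - exact: measurable_cap_itv.
  - apply/seteqP; split => // z /= [[_]]; rewrite !in_itv/=.
    by move=> /andP[_ zx] /andP[xz _]; move: xz; rewrite ltNge zx.
  apply: le_measure; rewrite ?inE; try exact: measurable_cap_itv.
    by apply: measurableU => //; exact: measurable_cap_itv.
  move=> z /= [[Uz]|]; rewrite !in_itv/= => /andP[h h'].
    by split => //; rewrite h (le_trans h').
  split; last by rewrite (le_lt_trans ax).
  by apply: xyU; rewrite /= in_itv/= ltW.
- rewrite big_ord_recr/= eqxx.
  under eq_bigr do rewrite ltn_eqF//.
  have : eps * (x - a) <= eps * (y - a) by apply: ler_wpM2l; [exact: ltW|rewrite lerD2r].
  have := ler_norm (f y - f x); move: h4; set S := \sum_(_ < _) _; lra.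
Qed.

Hypothesis slope : forall x, ~ U x -> derivable f x 1 /\ derive1 f x <= 0.

(** A point of the open set [U] has a whole neighbourhood in [U]; elsewhere the derivative is below
    [eps], hence so are the difference quotients on both sides of [s]. Only intervals containing [s]
    are treated, so that the two one-sided bounds can be added at [s]. *)
Lemma slope_or_cover s : exists2 r, 0 < r & forall x y, s - r < x -> x <= s ->
  s <= y -> y < s + r -> f y - f x <= eps * (y - x) \/ `[x, y] `<=` U.
Proof.
have [Us|nUs] := pselect (U s).
  have /nbhs_ballP[r /= r0 rU] := open_nbhs_nbhs (conj oU Us).
  exists r => // x y sx xs sy ys; right => z /=; rewrite in_itv/= => /andP[xz zy].
  by apply: rU; rewrite /ball/= ltr_norml; apply/andP; split; lra.
have [df f'0] := slope nUs.
have f'e : derive1 f s < eps by exact: le_lt_trans eps0.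
have cvf : h^-1 *: (f (h + s) - f s) @[h --> 0^'] --> derive1 f s.
  have := df; rewrite /derivable /derive1/=.
  by under eq_fun do rewrite [_ *: 1]mulr1.
have : \forall h \near 0^', h^-1 *: (f (h + s) - f s) < eps.
  exact: cvgr_lt _ cvf _ f'e.
move=> /nbhs_ballP[r /= r0 hr].
have sl (h : R) : `|h| < r -> h != 0 -> h^-1 * (f (h + s) - f s) < eps.
  by move=> hr' h0; apply: hr => //; rewrite /ball/= sub0r normrN.
exists r => // x y sx xs sy ys; left.
have h1 : f y - f s <= eps * (y - s).
  have [->|ys'] := eqVneq y s; first by rewrite !subrr mulr0.
  have ys0 : 0 < y - s by rewrite subr_gt0 lt_neqAle eq_sym ys'.
  have := sl (y - s); rewrite subrK gtr0_norm// => /(_ _ _)/ltW.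
  by rewrite mulrC ler_pdivrMr//; apply; [lra|rewrite gt_eqF].
have h2 : f s - f x <= eps * (s - x).
  have [->|xs'] := eqVneq x s; first by rewrite !subrr mulr0.
  have xs0 : 0 < s - x by rewrite subr_gt0 lt_neqAle xs'.
  have := sl (x - s); rewrite subrK distrC gtr0_norm// => /(_ _ _)/ltW.
  rewrite -(opprB s x) invrN mulNr -mulrN opprB mulrC ler_pdivrMr//.
  by rewrite opprB; apply; [lra|rewrite subr_eq0].
move: h1 h2; lra.
Qed.

(* A supremum argument replaces Cousin's lemma: no point s can be the last one
   reached, since an interval around s can be appended. *)
Lemma chain_to_end : a <= b -> chain_to b.
Proof.
move=> ab; set S := chain_to.
have S0 : S !=set0 by exists a; exact: chain_to_start.
have hS : has_sup S by split => //; exists b => x [_ []].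
set s := sup S.
have aS : a <= s by apply: ub_le_sup; [exact: hS.2|exact: chain_to_start].
have sb : s <= b by apply: ge_sup => // x [_ []].
have [r r0 hr] := slope_or_cover s.
have [x Sx sx] := sup_adherent r0 hS.
have xs : x <= s by apply: ub_le_sup => //; exact: hS.2.
(* Either [y] is [b] or it lies strictly beyond [s]; the latter is impossible, since points reached
   by a chain do not exceed the supremum. *)
pose y := Num.min b (s + r / 2).
have sy : s <= y by rewrite le_min sb; lra.
have yb : y <= b by rewrite ge_min lexx.
have ysr : y < s + r by rewrite gt_min; apply/orP; right; lra.
have Sy : S y.
  have [] := hr x y sx xs sy ysr.
    by apply: chain_to_slope => //; exact: le_trans sy.
  by apply: chain_to_cover => //; exact: le_trans sy.
have ys : y <= s by apply: ub_le_sup => //; exact: hS.2.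
suff <- : y = b by [].
apply/eqP; rewrite eq_le yb/=.
by move: ys; rewrite /y ge_min => /orP[/le_trans|]; [apply|lra].
Qed.

End growth_along_tagged_partition.

(** The exceptional null set is covered by an open set of measure below the [d] that absolute
    continuity supplies for [eps]. The chain reaching [b] then carries a charged growth below [eps],
    and the remaining growth is at most [eps * (b - a)]. *)
Lemma acloc_nonincreasing f : acloc f ->
  {ae mu, forall x, derivable f x 1 /\ derive1 f x <= 0} ->
  forall a b, a <= b -> f b <= f a.
Proof.
move=> acf aef a b ab; apply/ler_addgt0Pr => e e0.
(* Chosen so that the two errors [eps * (b - a)] and [eps] add up to [e]. *)
pose eps := e / (1 + (b - a)).
have ba0 : 0 < 1 + (b - a) by lra.
have eps0 : 0 < eps by rewrite divr_gt0.
have [d d0 hd] := acf a b ab eps eps0.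
have [U [oU NU muU]] := negligible_open_cover aef d0.
have sl x : ~ U x -> derivable f x 1 /\ derive1 f x <= 0.
  by move=> nUx; apply: contrapT => nfx; apply: nUx; apply: NU.
have [_ [_ [n [u [v [h1 h2 h3 h4]]]]]] := chain_to_end oU eps0 sl ab.
have : \sum_(k < n) `|f (v k) - f (u k)| < eps.
  apply: (hd n (u \o val) (v \o val)) => /=.
  - by move=> k; exact: h1.
  - move=> k l; rewrite -val_eqE/= neq_ltn => /orP[kl|lk]; [left|right].
      exact: h2.
    exact: h2.
  - rewrite -lte_fin; apply: le_lt_trans muU; apply: (le_trans h3).
    apply: le_measure; rewrite ?inE; [exact: measurable_cap_itv|exact: open_measurable|].
    exact: subIsetl.
move=> h5; rewrite -lerBlDl; apply: (le_trans h4).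
have -> : e = eps * (b - a) + eps by rewrite /eps; field; rewrite gt_eqF.
by rewrite lerD2l ltW.
Qed.

Lemma acloc_const f : acloc f ->
  {ae mu, forall x, derivable f x 1 /\ derive1 f x = 0} -> forall a b, f a = f b.
Proof.
move=> acf aef; suff W a b : a <= b -> f a = f b.
  by move=> a b; have [/W//|/ltW/W->] := leP a b.
move=> ab; apply/eqP; rewrite eq_le; apply/andP; split; last first.
  apply: acloc_nonincreasing ab => //.
  by apply: ae_imp aef => x [? ->].
rewrite -lerN2; apply: (@acloc_nonincreasing (fun x => - f x)) ab; first exact: aclocN.
apply: ae_imp aef => x [df f'0]; split; first exact: derivableN.
by rewrite derive1E deriveN// -derive1E f'0 oppr0.
Qed.

End Monotone.

(** * Complex-valued functions *)

Section ComplexCalculus.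
Variable R : realType.
Local Notation C := R[i].
Local Notation mu := (@lebesgue_measure R).
Implicit Types (z w : C) (f g : R -> C) (x : R).

Lemma complex_ext z w : complex.Re z = complex.Re w ->
  complex.Im z = complex.Im w -> z = w.
Proof. by case: z w => [a b] [c d] /= -> ->. Qed.

Lemma Re_mul z w : complex.Re (z * w) =
  complex.Re z * complex.Re w - complex.Im z * complex.Im w.
Proof. by case: z w => [a b] [c d]. Qed.

Lemma Im_mul z w : complex.Im (z * w) =
  complex.Re z * complex.Im w + complex.Im z * complex.Re w.
Proof. by case: z w => [a b] [c d]. Qed.

Lemma Re_add z w : complex.Re (z + w) = complex.Re z + complex.Re w.
Proof. by case: z w => [a b] [c d]. Qed.

Lemma Im_add z w : complex.Im (z + w) = complex.Im z + complex.Im w.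
Proof. by case: z w => [a b] [c d]. Qed.

Lemma Re_opp z : complex.Re (- z) = - complex.Re z.
Proof. by case: z. Qed.

Lemma Im_opp z : complex.Im (- z) = - complex.Im z.
Proof. by case: z. Qed.

Lemma Re_i : complex.Re ('i : C) = 0.
Proof. by rewrite -complexiE. Qed.

Lemma Im_i : complex.Im ('i : C) = 1.
Proof. by rewrite -complexiE. Qed.

Definition ReImE := (Re_mul, Im_mul, Re_add, Im_add, Re_opp, Im_opp, Re_i, Im_i).

Lemma mulii : 'i * 'i = -1 :> C.
Proof. by rewrite -expr2 sqrCi. Qed.

Lemma cconjD z w : cconj (z + w) = cconj z + cconj w.
Proof. by case: z w => [a b] [c d]; apply: complex_ext => //=; rewrite opprD. Qed.

Lemma cconjN z : cconj (- z) = - cconj z.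
Proof. by case: z. Qed.

Lemma cconjM z w : cconj (z * w) = cconj z * cconj w.
Proof. by case: z w => [a b] [c d]; apply: complex_ext => //=; ring. Qed.

Lemma cconjK z : cconj (cconj z) = z.
Proof. by case: z => a b; apply: complex_ext => //=; rewrite opprK. Qed.

Lemma cconji : cconj 'i = - 'i :> C.
Proof. by rewrite -complexiE; apply: complex_ext; rewrite //= oppr0. Qed.

Lemma cconj_real (a : R) : cconj a%:C%C = a%:C%C.
Proof. by apply: complex_ext; rewrite //= oppr0. Qed.

Lemma csqE z : (csq z)%:C%C = z * cconj z.
Proof. by case: z => a b; apply: complex_ext; rewrite /csq//=; ring. Qed.

Lemma csq_ge0 z : 0 <= csq z.
Proof. by rewrite addr_ge0// sqr_ge0. Qed.

Lemma csqM z w : csq (z * w) = csq z * csq w.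
Proof. by rewrite /csq !ReImE; ring. Qed.

Lemma csq_conj z : csq (cconj z) = csq z.
Proof. by rewrite /csq/= sqrrN. Qed.

Lemma csqN z : csq (- z) = csq z.
Proof. by rewrite /csq !ReImE !sqrrN. Qed.

Lemma csq_eq0 z : (csq z == 0) = (z == 0).
Proof.
rewrite /csq paddr_eq0 ?sqr_ge0// !sqrf_eq0; case: z => a b /=.
by rewrite eq_complex.
Qed.

Lemma csqD_le z w : csq (z + w) <= 2 * (csq z + csq w).
Proof.
rewrite /csq !ReImE.
have := sqr_ge0 (complex.Re z - complex.Re w).
have := sqr_ge0 (complex.Im z - complex.Im w).
rewrite !sqrrB !sqrrD !mulr2n; lra.
Qed.

Lemma four_Im z : (4 * complex.Im z)%:C%C = - (2 * 'i * (z - cconj z)).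
Proof.
rewrite -complexiE; case: z => a b; apply: complex_ext => /=; rewrite ?ReImE/=; ring.
Qed.

Definition has_cderiv f x (d : C) := cderivable f x /\ cderiv f x = d.

Lemma has_cderivP f x d : has_cderiv f x d <->
  is_derive x 1 (reP f) (complex.Re d) /\ is_derive x 1 (imP f) (complex.Im d).
Proof.
split=> [[[df1 df2] <-]|[[df1 e1] [df2 e2]]].
  by split; apply: DeriveDef => //=; rewrite derive1E.
by split => //; apply: complex_ext; rewrite /= derive1E.
Qed.

Lemma has_cderiv_cst (c : C) x : has_cderiv (fun=> c) x 0.
Proof. by apply/has_cderivP; split; exact: is_derive_cst. Qed.

Lemma has_cderiv_add f g x d e : has_cderiv f x d -> has_cderiv g x e -> has_cderiv (fun y => f y + g y) x (d + e).
Proof.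
move=> /has_cderivP[f1 f2] /has_cderivP[g1 g2]; apply/has_cderivP; rewrite Re_add Im_add; split.
  rewrite (_ : reP _ = reP f \+ reP g); last by apply/funext => y; rewrite /reP Re_add.
  exact: is_deriveD.
rewrite (_ : imP _ = imP f \+ imP g); last by apply/funext => y; rewrite /imP Im_add.
exact: is_deriveD.
Qed.

Lemma has_cderiv_mul f g x d e : has_cderiv f x d -> has_cderiv g x e ->
  has_cderiv (fun y => f y * g y) x (d * g x + f x * e).
Proof.
move=> /has_cderivP[f1 f2] /has_cderivP[g1 g2]; apply/has_cderivP; split.
  rewrite (_ : reP _ = reP f * reP g - imP f * imP g); last first.
    by apply/funext => y; rewrite /reP Re_mul.
  apply: is_derive_eq; rewrite !ReImE /GRing.scale/= /reP /imP; ring.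
rewrite (_ : imP _ = reP f * imP g + imP f * reP g); last first.
  by apply/funext => y; rewrite /imP Im_mul.
apply: is_derive_eq; rewrite !ReImE /GRing.scale/= /reP /imP; ring.
Qed.

Lemma has_cderiv_scale (c : C) f x d : has_cderiv f x d -> has_cderiv (fun y => c * f y) x (c * d).
Proof.
by move=> /(has_cderiv_mul (has_cderiv_cst c x)); rewrite mul0r add0r.
Qed.

Lemma has_cderiv_opp f x d : has_cderiv f x d -> has_cderiv (fun y => - f y) x (- d).
Proof.
move=> /(has_cderiv_scale (-1)); rewrite mulN1r.
by under eq_fun do rewrite mulN1r.
Qed.

Lemma has_cderiv_conj f x d : has_cderiv f x d -> has_cderiv (fun y => cconj (f y)) x (cconj d).
Proof.
by move=> /has_cderivP[f1 f2]; apply/has_cderivP; split => //; exact: is_deriveN.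
Qed.

(** The only complex-valued reciprocal to be differentiated is that of |Psi|^2, so the real rule
    suffices once [d] is seen to be real. *)
Lemma has_cderiv_inv_real (g : R -> R) f x d : (forall y, f y = (g y)%:C%C) -> f x != 0 ->
  has_cderiv f x d -> has_cderiv (fun y => (f y)^-1) x (- d / f x ^+ 2).
Proof.
move=> fE; have -> : f = (fun y => (g y)%:C%C) by apply/funext.
move=> gx0 /has_cderivP[/= g1 g2].
have {}g1 : is_derive x 1 g (complex.Re d) := g1.
have g0 : g x != 0 by apply: contraNneq gx0 => ->.
have d0 : complex.Im d = 0.
  have [_ <-] := g2; rewrite (_ : imP _ = cst 0)//; exact: derive_cst.
have dE : d = (complex.Re d)%:C%C by apply: complex_ext.
have -> : - d / (g x)%:C%C ^+ 2 = (- (g x) ^- 2 * complex.Re d)%:C%C.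
  by rewrite {1}dE !rmorphM/= rmorphN/= fmorphV/= rmorphXn/=; ring.
have -> : (fun y => ((g y)%:C%C)^-1) = (fun y => ((g y)^-1)%:C%C) :> (R -> C).
  by apply/funext => y; rewrite fmorphV.
apply/has_cderivP; split; first exact: is_deriveV.
exact: is_derive_cst.
Qed.

Lemma cACloc_acloc f : cACloc f <-> acloc (reP f) /\ acloc (imP f).
Proof.
split=> [h|[h1 h2] a b ab]; last by split; [exact: h1|exact: h2].
by split => a b /h[].
Qed.

Lemma cAC_cst (c : C) : cACloc (fun=> c).
Proof. by apply/cACloc_acloc; split; exact: acloc_cst. Qed.

Lemma cAC_add f g : cACloc f -> cACloc g -> cACloc (fun x => f x + g x).
Proof.
move=> /cACloc_acloc[f1 f2] /cACloc_acloc[g1 g2]; apply/cACloc_acloc; split.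
  by apply: aclocP (aclocD f1 g1) _ => x; rewrite /reP Re_add.
by apply: aclocP (aclocD f2 g2) _ => x; rewrite /imP Im_add.
Qed.

Lemma cAC_mul f g : cACloc f -> cACloc g -> cACloc (fun x => f x * g x).
Proof.
move=> /cACloc_acloc[f1 f2] /cACloc_acloc[g1 g2]; apply/cACloc_acloc; split.
  apply: aclocP (aclocD (aclocM f1 g1) (aclocN (aclocM f2 g2))) _ => x.
  by rewrite /reP Re_mul.
apply: aclocP (aclocD (aclocM f1 g2) (aclocM f2 g1)) _ => x.
by rewrite /imP Im_mul.
Qed.

Lemma cAC_opp f : cACloc f -> cACloc (fun x => - f x).
Proof.
move=> /cACloc_acloc[f1 f2]; apply/cACloc_acloc; split.
  by apply: aclocP (aclocN f1) _ => x; rewrite /reP Re_opp.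
by apply: aclocP (aclocN f2) _ => x; rewrite /imP Im_opp.
Qed.

Lemma cAC_conj f : cACloc f -> cACloc (fun x => cconj (f x)).
Proof. by move=> /cACloc_acloc[f1 f2]; apply/cACloc_acloc; split => //; exact: aclocN. Qed.

Lemma cAC_inv_real (g : R -> R) f : (forall x, f x = (g x)%:C%C) ->
  (forall x, f x != 0) -> cACloc f -> cACloc (fun x => (f x)^-1).
Proof.
move=> fE; have -> : f = (fun y => (g y)%:C%C) by apply/funext.
move=> f0 /cACloc_acloc[/= f1 f2]; apply/cACloc_acloc.
have {}f1 : acloc g := f1.
split.
  apply: aclocP (aclocV _ f1) _ => x; last by rewrite /reP -fmorphV.
  by apply: contraNneq (f0 x) => ->.
by apply: aclocP (@acloc_cst _ 0) _ => x; rewrite /imP -fmorphV.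
Qed.

Lemma cAC_cmeas D f : cACloc f -> cmeas D f.
Proof.
move=> /cACloc_acloc[f1 f2].
split; apply: measurable_funTS; apply: continuous_measurable_fun.
  exact: acloc_continuous f1.
exact: acloc_continuous f2.
Qed.

Lemma cAC_const f : cACloc f -> {ae mu, forall x, has_cderiv f x 0} -> forall x y, f x = f y.
Proof.
move=> /cACloc_acloc[f1 f2] fae x y; apply: complex_ext.
  suff h : {ae mu, forall x, derivable (reP f) x 1 /\ derive1 (reP f) x = 0}.
    exact: (acloc_const f1 h x y).
  by apply: ae_imp fae => t [[d1 d2]] /(congr1 (@complex.Re R)).
suff h : {ae mu, forall x, derivable (imP f) x 1 /\ derive1 (imP f) x = 0}.
  exact: (acloc_const f2 h x y).
by apply: ae_imp fae => t [[d1 d2]] /(congr1 (@complex.Im R)).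
Qed.

End ComplexCalculus.

(** * The Darboux transformation *)

(* [field] fails when terms [cconj _] occur as atoms. *)
Ltac generalize_cconj := repeat match goal with
  |- context [cconj ?u] => let a := fresh "a" in move: (cconj u) => a end.

(** * Projections and conjugation on the fibre C^2 *)

Section PointwiseAlgebra.
Variable R : realType.
Local Notation C := R[i].
Local Notation mu := (@lebesgue_measure R).
Implicit Types (u v p : C * C) (a b c z : C) (x : R) (F G : vfun R).

Definition padd u v : C * C := (u.1 + v.1, u.2 + v.2).
Definition pscale c u : C * C := (c * u.1, c * u.2).
Definition dot u v : C := u.1 * cconj v.1 + u.2 * cconj v.2.
Definition sigma3 u : C * C := (u.1, - u.2).
(** At [p = (0, 0)] division by zero makes this the zero map, so it is a contraction for every
    [p]. *)
Definition proj p u : C * C := pscale (dot u p / dot p p) p.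
Definition sproj p u : C * C := sigma3 (proj p (sigma3 u)).
Definition kconj u : C * C := (cconj u.2, - cconj u.1).
Definition normsq u : R := csq u.1 + csq u.2.

Lemma pair_ext u v : u.1 = v.1 -> u.2 = v.2 -> u = v.
Proof. by case: u v => [? ?] [? ?] /= -> ->. Qed.

Lemma normsqE u : (normsq u)%:C%C = dot u u.
Proof. by rewrite /normsq rmorphD/= !csqE. Qed.

Lemma normsq_ge0 u : 0 <= normsq u.
Proof. by rewrite addr_ge0 ?csq_ge0. Qed.

Lemma normsq_eq0 u : (normsq u == 0) = (u == (0, 0)).
Proof.
by rewrite /normsq paddr_eq0 ?csq_ge0// !csq_eq0; case: u => a b; rewrite xpair_eqE.
Qed.

Lemma normsq_gt0 u : u <> (0, 0) -> 0 < normsq u.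
Proof. by move=> /eqP u0; rewrite lt_neqAle normsq_ge0 eq_sym normsq_eq0 u0. Qed.

Lemma normsq_pscale c u : normsq (pscale c u) = csq c * normsq u.
Proof. by rewrite /normsq /= !csqM -mulrDr. Qed.

Lemma normsq_padd u v : normsq (padd u v) <= 2 * (normsq u + normsq v).
Proof.
rewrite /normsq; have := csqD_le u.1 v.1; have := csqD_le u.2 v.2; lra.
Qed.

Lemma normsq_sigma3 u : normsq (sigma3 u) = normsq u.
Proof. by rewrite /normsq /= csqN. Qed.

Lemma normsq_kconj u : normsq (kconj u) = normsq u.
Proof. by rewrite /normsq /= csqN !csq_conj addrC. Qed.

Lemma dot_eq0 u : (dot u u == 0) = (u == (0, 0)).
Proof.
rewrite -normsq_eq0 -normsqE; apply/idP/idP => [/eqP/(congr1 (@complex.Re R))/= ->//|].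
by move=> /eqP ->.
Qed.

(* Lagrange's identity: the defect in Cauchy-Schwarz is |u x v|^2. *)
Lemma csq_dot_le u v : csq (dot u v) <= normsq u * normsq v.
Proof.
have -> : normsq u * normsq v = csq (dot u v) + csq (u.1 * v.2 - u.2 * v.1).
  by rewrite /normsq /dot /csq !ReImE/=; ring.
by rewrite lerDl csq_ge0.
Qed.

(** The other summand of the same identity; with a constant Wronskian on the left it bounds 1/|Psi|
    from above. *)
Lemma csq_det_le u v : csq (u.1 * v.2 - u.2 * v.1) <= normsq u * normsq v.
Proof.
have -> : normsq u * normsq v = csq (dot u v) + csq (u.1 * v.2 - u.2 * v.1).
  by rewrite /normsq /dot /csq !ReImE/=; ring.
by rewrite lerDr csq_ge0.
Qed.

Lemma csqV z : csq z^-1 = (csq z)^-1.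
Proof.
have [->|z0] := eqVneq z 0; first by rewrite invr0 /csq/= !expr0n/= addr0 invr0.
apply: (mulfI (x := csq z)); first by rewrite csq_eq0.
by rewrite -csqM !divff ?csq_eq0// /csq/= expr1n expr0n addr0.
Qed.

Lemma normsq_proj p u : normsq (proj p u) <= normsq u.
Proof.
have [->|p0] := eqVneq p (0, 0).
  by rewrite /proj /normsq/= !mulr0 /csq/= !expr0n/= !addr0 addr_ge0// csq_ge0.
rewrite normsq_pscale csqM csqV -normsqE.
have np : 0 < normsq p by apply: normsq_gt0; apply/eqP.
have -> : csq (normsq p)%:C%C = normsq p ^+ 2 by rewrite /csq/= expr0n addr0.
have -> : csq (dot u p) / normsq p ^+ 2 * normsq p = csq (dot u p) / normsq p.
  by field; rewrite gt_eqF.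
by rewrite ler_pdivrMr// csq_dot_le.
Qed.

Lemma normsq_sproj p u : normsq (sproj p u) <= normsq u.
Proof. by rewrite normsq_sigma3; apply: le_trans (normsq_proj _ _) _; rewrite normsq_sigma3. Qed.

Lemma dot_pscale c u v : dot (pscale c u) v = c * dot u v.
Proof. by rewrite /dot/=; ring. Qed.

Lemma dot_padd u v p : dot (padd u v) p = dot u p + dot v p.
Proof. by rewrite /dot/=; ring. Qed.

Lemma proj_pscale p c u : proj p (pscale c u) = pscale c (proj p u).
Proof. by rewrite /proj dot_pscale; apply: pair_ext => /=; ring. Qed.

Lemma proj_padd p u v : proj p (padd u v) = padd (proj p u) (proj p v).
Proof. by rewrite /proj dot_padd; apply: pair_ext => /=; ring. Qed.

Lemma sigma3_pscale c u : sigma3 (pscale c u) = pscale c (sigma3 u).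
Proof. by apply: pair_ext => //=; ring. Qed.

Lemma sigma3_padd u v : sigma3 (padd u v) = padd (sigma3 u) (sigma3 v).
Proof. by apply: pair_ext => //=; ring. Qed.

Lemma sigma3K : involutive sigma3.
Proof. by move=> [a b]; rewrite /sigma3/= opprK. Qed.

Lemma sproj_pscale p c u : sproj p (pscale c u) = pscale c (sproj p u).
Proof. by rewrite /sproj sigma3_pscale proj_pscale sigma3_pscale. Qed.

Lemma sproj_padd p u v : sproj p (padd u v) = padd (sproj p u) (sproj p v).
Proof. by rewrite /sproj sigma3_padd proj_padd sigma3_padd. Qed.

Lemma proj_idem p u : p <> (0, 0) -> proj p (proj p u) = proj p u.
Proof.
move=> /eqP; rewrite -dot_eq0 => p0; rewrite {1}/proj dot_pscale.
by congr pscale; field.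
Qed.

Lemma sproj_idem p u : p <> (0, 0) -> sproj p (sproj p u) = sproj p u.
Proof. by move=> p0; rewrite /sproj sigma3K proj_idem. Qed.

(** * Pointwise form of the intertwining relation, for abstract linear maps *)

Section DressingIdentities.
Variables P S : C * C -> C * C.
Hypotheses (Ppa : forall u v, P (padd u v) = padd (P u) (P v))
  (Pps : forall c u, P (pscale c u) = pscale c (P u))
  (Spa : forall u v, S (padd u v) = padd (S u) (S v))
  (Sps : forall c u, S (pscale c u) = pscale c (S u)).

(* [c] stands for the conjugate of [z1]. *)
Lemma dress_identity u v (z z1 c : C) : P (P u) = P u ->
  let w := padd v (pscale z u) in
  let t := padd (pscale (z - c) u) (pscale (c - z1) (P u)) in
  padd (padd (pscale (z - c) w) (pscale (c - z1)
       (padd (padd (S w) (pscale (- c) (S u)))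
           (padd (pscale z1 (P u)) (pscale (c - z1) (S (P u)))))))
     (pscale (z1 - c) (padd (S t) (pscale (-1) (P t)))) =
  padd (padd (pscale (z - c) v) (pscale (c - z1) (S v))) (pscale z t).
Proof.
move=> idem w t; rewrite /w /t !(Ppa, Spa, Pps, Sps) idem.
by apply: pair_ext; rewrite /=; ring.
Qed.

(** The coefficients [z - z1] and [z1 - c] are those of [(z - z1) (z - c)] times the inverse of [T].
    Here the change of potential sits inside [w], so it is [S] that meets [S u]; in the forward
    direction [P] meets [P u]. *)
Lemma undress_identity u v (z z1 c : C) : S (S u) = S u ->
  let w := padd (padd v (pscale z u)) (pscale (c - z1) (padd (S u) (pscale (-1) (P u)))) in
  let t := padd (pscale (z - z1) u) (pscale (z1 - c) (P u)) in
  padd (pscale (z - z1) w) (pscale (z1 - c)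
       (padd (padd (S w) (pscale (- c) (S u)))
           (padd (pscale z1 (P u)) (pscale (c - z1) (S (P u)))))) =
  padd (padd (pscale (z - z1) v) (pscale (z1 - c) (S v))) (pscale z t).
Proof.
move=> idem w t; rewrite /w /t !(Ppa, Spa, Pps, Sps) idem.
by apply: pair_ext; rewrite /=; ring.
Qed.

End DressingIdentities.

End PointwiseAlgebra.

(** * The relation M(q)F = G and its Darboux transform *)

Section MaximalRelation.
Variable R : realType.
Local Notation C := R[i].
Local Notation mu := (@lebesgue_measure R).
Implicit Types (a b c z : C) (x : R) (F G : vfun R) (q : R -> C).

Definition Mrel_at q F G x :=
  has_cderiv (fun y => (F y).1) x (- ('i * (G x).1) + q x * (F x).2) /\
  has_cderiv (fun y => (F y).2) x ('i * (G x).2 - cconj (q x) * (F x).1).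

Lemma MrelP q F G : Mrel q F G <-> {ae mu, forall x, Mrel_at q F G x}.
Proof.
split; apply: ae_imp => x.
  move=> [d1 [d2 [e1 e2]]]; rewrite /Mrel_at /has_cderiv -e1 -e2.
  by split; split => //; rewrite !mulrA mulii; ring.
move=> [[d1 e1] [d2 e2]]; rewrite e1 e2; do !split => //.
  by rewrite addrK mulrN mulrA mulii; ring.
set A := cconj _ * _; rewrite (_ : _ - _ = - 'i * (G x).2); last by rewrite /A; ring.
by rewrite mulNr mulrN mulrA mulii; ring.
Qed.

Lemma waveP q z F : wave q z F <->
  [/\ ACloc F, exists x, F x <> (0, 0) & Mrel q F (vscale z F)].
Proof.
have E : {ae mu, forall x, cderivable (fun y => (F y).1) x /\
    cderivable (fun y => (F y).2) x /\
    cderiv (fun y => (F y).1) x = - 'i * z * (F x).1 + q x * (F x).2 /\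
    cderiv (fun y => (F y).2) x = 'i * z * (F x).2 - cconj (q x) * (F x).1} <->
  Mrel q F (vscale z F).
  rewrite MrelP; split; apply: ae_imp => x.
    by move=> [d1 [d2 [e1 e2]]]; split; split => //; rewrite ?e1 ?e2/=; ring.
  by move=> [[d1 e1] [d2 e2]]; rewrite e1 e2/=; do !split => //; ring.
split; first by move=> [acF [[x /eqP nz] /E]]; split => //; exists x.
by move=> [acF [x /eqP nz] /E]; do !split => //; exists x.
Qed.

Lemma Mrel_ext q F G G' : (forall x, G x = G' x) -> Mrel q F G -> Mrel q F G'.
Proof. by move=> /funext ->. Qed.

Lemma Mrel_lin q a b F F' G G' : Mrel q F G -> Mrel q F' G' ->
  Mrel q (vadd (vscale a F) (vscale b F')) (vadd (vscale a G) (vscale b G')).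
Proof.
move=> /MrelP h /MrelP h'; apply/MrelP; apply: ae_imp2 h h' => x [d1 d2] [d1' d2'].
split.
  have := has_cderiv_add (has_cderiv_scale a d1) (has_cderiv_scale b d1'); congr has_cderiv => /=; ring.
have := has_cderiv_add (has_cderiv_scale a d2) (has_cderiv_scale b d2'); congr has_cderiv => /=; ring.
Qed.

Lemma Mrel_scale q c F G : Mrel q F G -> Mrel q (vscale c F) (vscale c G).
Proof.
move=> /MrelP h; apply/MrelP; apply: ae_imp h => x [d1 d2]; split.
  have := has_cderiv_scale c d1; congr has_cderiv => /=; ring.
have := has_cderiv_scale c d2; congr has_cderiv => /=; ring.
Qed.

Definition vkconj F : vfun R := fun x => kconj (F x).

(** M(q) commutes with the antilinear map K, which therefore turns solutions at [z] into solutions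
    at [conj z] for the same potential. *)
Lemma Mrel_vkconj q F G : Mrel q F G -> Mrel q (vkconj F) (vkconj G).
Proof.
move=> /MrelP h; apply/MrelP; apply: ae_imp h => x [d1 d2]; split.
  have := has_cderiv_conj d2; congr has_cderiv.
  by rewrite cconjD cconjN !cconjM cconji cconjK/=; ring.
have := has_cderiv_opp (has_cderiv_conj d1); congr has_cderiv.
by rewrite cconjD cconjN !cconjM cconji/=; ring.
Qed.

Section Darboux.
Variables (q q' : R -> C) (z1 : C) (Psi : vfun R).
Hypothesis Psi0 : forall x, Psi x <> (0, 0).
Hypothesis q'E : forall x, q' x = q x -
  2 * 'i * (z1 - cconj z1) * (Psi x).1 * cconj (Psi x).2 / dot (Psi x) (Psi x).
Hypothesis MPsi : Mrel q Psi (vscale z1 Psi).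

Definition vproj F : vfun R := fun x => proj (Psi x) (F x).
Definition vsproj F : vfun R := fun x => sproj (Psi x) (F x).

Lemma dotPsi0 x : dot (Psi x) (Psi x) != 0.
Proof. by rewrite dot_eq0; apply/eqP. Qed.

Lemma Mrel_at_invdot x : Mrel_at q Psi (vscale z1 Psi) x ->
  has_cderiv (fun y => (dot (Psi y) (Psi y))^-1) x
     (- ('i * (cconj z1 - z1) * ((Psi x).1 * cconj (Psi x).1 -
        (Psi x).2 * cconj (Psi x).2)) / dot (Psi x) (Psi x) ^+ 2).
Proof.
move=> [d1 d2].
have := has_cderiv_add (has_cderiv_mul d1 (has_cderiv_conj d1)) (has_cderiv_mul d2 (has_cderiv_conj d2)).
move=> /(@has_cderiv_inv_real R (fun y => normsq (Psi y)) (fun y => dot (Psi y) (Psi y))).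
move=> /(_ (fun y => esym (normsqE _)) (dotPsi0 x)); congr has_cderiv.
congr (- _ / _); rewrite !(cconjD, cconjN, cconjM, cconji, cconjK)/=; ring.
Qed.

(** For a scalar function [a], M(q)(a Psi) = z1 a Psi + i a' sigma_3 Psi. With a = <F, Psi> /
    |Psi|^2 the first term is [z1 P F] and the second lies in the range of [S]: differentiating [F],
    the conjugate of Psi and 1/|Psi|^2 yields the three terms with [S], while the potential cancels
    between the first two. *)
Lemma Mrel_vproj F G : Mrel q F G -> Mrel q (vproj F)
  (fun x => padd (padd (sproj (Psi x) (G x)) (pscale (- cconj z1) (sproj (Psi x) (F x))))
    (padd (pscale z1 (proj (Psi x) (F x)))
      (pscale (cconj z1 - z1) (sproj (Psi x) (proj (Psi x) (F x)))))).
Proof.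
move=> /MrelP h; move/MrelP: MPsi => hPsi; apply/MrelP.
apply: ae_imp2 h hPsi => x [d1 d2] D.
have dn := Mrel_at_invdot D; have [p1 p2] := D.
have n0 := dotPsi0 x; rewrite /dot in n0.
have dd := has_cderiv_add (has_cderiv_mul d1 (has_cderiv_conj p1)) (has_cderiv_mul d2 (has_cderiv_conj p2)).
have ds := has_cderiv_mul dd dn.
split.
  have := has_cderiv_mul ds p1; congr has_cderiv.
  rewrite /vscale/= !(cconjD, cconjN, cconjM, cconji, cconjK) /sproj /proj /pscale /padd /sigma3 /dot/=.
  by move: n0; generalize_cconj => n0; field.

have := has_cderiv_mul ds p2; congr has_cderiv.
rewrite /vscale/= !(cconjD, cconjN, cconjM, cconji, cconjK) /sproj /proj /pscale /padd /sigma3 /dot/=.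
by move: n0; generalize_cconj => n0; field.
Qed.


Lemma cconj_q' x : cconj (q' x) = cconj (q x) +
  2 * 'i * (cconj z1 - z1) * cconj (Psi x).1 * (Psi x).2 / dot (Psi x) (Psi x).
Proof.
have c2 : cconj 2 = 2 :> C by have := @cconj_real R 2; rewrite rmorph_nat.
have cV : cconj (dot (Psi x) (Psi x))^-1 = (dot (Psi x) (Psi x))^-1.
  by rewrite -normsqE -fmorphV cconj_real.
rewrite q'E cconjD cconjN 5!cconjM c2 cV cconji cconjK cconjD cconjN cconjK.
generalize_cconj; ring.
Qed.

(** As a matrix this is minus twice the off-diagonal part of [P]; times [z1 - conj z1] its upper
    right entry is [-i (q' - q)], that of M(q') - M(q). *)
Definition offdiag F x := padd (vsproj F x) (pscale (-1) (vproj F x)).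

Lemma Mrel_darboux F G : Mrel q F G ->
  Mrel q' F (fun x => padd (G x) (pscale (z1 - cconj z1) (offdiag F x))).
Proof.
move=> /MrelP h; apply/MrelP; apply: ae_imp h => x [d1 d2].
have n0 := dotPsi0 x; split.
  move: d1; congr has_cderiv; rewrite q'E /offdiag /vsproj /vproj /sproj /proj /pscale /padd /sigma3/=.
  by move: n0; rewrite /dot/=; generalize_cconj => n0; field.
move: d2; congr has_cderiv; rewrite cconj_q' /offdiag /vsproj /vproj /sproj /proj /pscale /padd /sigma3/=.
by move: n0; rewrite /dot/=; generalize_cconj => n0; field.
Qed.

Lemma Mrel_undarboux F G : Mrel q' F G ->
  Mrel q F (fun x => padd (G x) (pscale (cconj z1 - z1) (offdiag F x))).
Proof.
move=> /MrelP h; apply/MrelP; apply: ae_imp h => x [d1 d2].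
have n0 := dotPsi0 x; split.
  move: d1; congr has_cderiv; rewrite q'E /offdiag /vsproj /vproj /sproj /proj /pscale /padd /sigma3/=.
  by move: n0; rewrite /dot/=; generalize_cconj => n0; field.
move: d2; congr has_cderiv; rewrite cconj_q' /offdiag /vsproj /vproj /sproj /proj /pscale /padd /sigma3/=.
by move: n0; rewrite /dot/=; generalize_cconj => n0; field.
Qed.

(* [sdress] is [dress] conjugated by sigma_3; it acts on right-hand sides,
   as the leading part of M(q) is i sigma_3 d/dx. *)
Definition dress a b F : vfun R := fun x => padd (pscale a (F x)) (pscale b (vproj F x)).
Definition sdress a b F : vfun R := fun x => padd (pscale a (F x)) (pscale b (vsproj F x)).

Lemma Mrel_dress z F G : Mrel q F (vadd G (vscale z F)) ->
  Mrel q' (dress (z - cconj z1) (cconj z1 - z1) F)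
    (vadd (sdress (z - cconj z1) (cconj z1 - z1) G)
      (vscale z (dress (z - cconj z1) (cconj z1 - z1) F))).
Proof.
move=> M; have M' := Mrel_lin (z - cconj z1) (cconj z1 - z1) M (Mrel_vproj M).
have := Mrel_darboux M'; apply: Mrel_ext => x.
exact: (dress_identity (proj_padd (Psi x)) (proj_pscale (Psi x)) (sproj_padd (Psi x)) (sproj_pscale (Psi x))
  (G x) z z1 (cconj z1) (proj_idem (F x) (@Psi0 x))).
Qed.

Lemma Mrel_undress z F G : Mrel q' F (vadd G (vscale z F)) ->
  Mrel q (dress (z - z1) (z1 - cconj z1) F)
    (vadd (sdress (z - z1) (z1 - cconj z1) G)
      (vscale z (dress (z - z1) (z1 - cconj z1) F))).
Proof.
move=> M'; have M := Mrel_undarboux M'.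
have := Mrel_lin (z - z1) (z1 - cconj z1) M (Mrel_vproj M); apply: Mrel_ext => x.
exact: (undress_identity (proj (Psi x)) (sproj_padd (Psi x)) (sproj_pscale (Psi x)) (G x)
  z z1 (cconj z1) (sproj_idem (F x) (@Psi0 x))).
Qed.

Definition phi : vfun R := fun x => pscale (dot (Psi x) (Psi x))^-1 (kconj (Psi x)).

Lemma Mrel_phi : Mrel q' phi (vscale z1 phi).
Proof.
move/MrelP: MPsi => h; apply/MrelP; apply: ae_imp h => x D.
have dn := Mrel_at_invdot D; have [p1 p2] := D; have n0 := dotPsi0 x.
split.
  have := has_cderiv_mul dn (has_cderiv_conj p2); congr has_cderiv.
  rewrite q'E cconjD cconjN !cconjM cconji cconjK/=.
  by move: n0; rewrite /dot/=; generalize_cconj => n0; field.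
have := has_cderiv_mul dn (has_cderiv_opp (has_cderiv_conj p1)); congr has_cderiv.
rewrite cconj_q' cconjD cconjN !cconjM cconji/=.
by move: n0; rewrite /dot/=; generalize_cconj => n0; field.
Qed.

(** Being orthogonal to Psi, [w] is [a phi] with [a] the determinant of [w] and Psi. These two solve
    equations with different potentials, so [a] is not constant for a general [w]; its derivative is
    a multiple of [<w, Psi>], which is zero here. *)
Lemma Mrel_kernel w : ACloc w -> ACloc Psi -> Mrel q' w (vscale z1 w) ->
  (forall x, vproj w x = (0, 0)) -> exists a, forall x, w x = pscale a (phi x).
Proof.
move=> acw acP Mw Pw.
have dw x : dot (w x) (Psi x) = 0.
  have := Pw x; rewrite /vproj /proj => -[e1 e2].
  have n0 := dotPsi0 x.
  have : dot (w x) (Psi x) / dot (Psi x) (Psi x) * dot (Psi x) (Psi x) = 0.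
    by rewrite {3}/dot mulrDr !mulrA e1 e2 !mul0r addr0.
  by rewrite divfK.
pose a x := (w x).1 * (Psi x).2 - (w x).2 * (Psi x).1.
have aE x : w x = pscale (a x) (phi x).
  have n0 := dotPsi0 x; apply: pair_ext => /=; apply: (mulIf n0); rewrite mulrCA.
    rewrite mulrAC mulVf// mul1r.
    transitivity (a x * cconj (Psi x).2 + (Psi x).1 * dot (w x) (Psi x)).
      by rewrite /a /dot; generalize_cconj; ring.
    by rewrite dw mulr0 addr0.
  rewrite mulrAC mulVf// mul1r.
  transitivity (- (a x * cconj (Psi x).1) + (Psi x).2 * dot (w x) (Psi x)).
    by rewrite /a /dot; generalize_cconj; ring.
  by rewrite dw mulr0 addr0 mulrN.
exists (a 0) => x; rewrite {1}aE; congr pscale.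
apply: cAC_const.
  apply: cAC_add; first exact: cAC_mul acw.1 acP.2.
  by apply: cAC_opp; exact: cAC_mul acw.2 acP.1.
move/MrelP: MPsi => hP; move/MrelP: Mw => hw; apply: ae_imp2 hP hw => t [p1 p2] [w1 w2].
have := has_cderiv_add (has_cderiv_mul w1 p2) (has_cderiv_opp (has_cderiv_mul w2 p1)); congr has_cderiv.
have n0 := dotPsi0 t.
(* What is left of the derivative is [(q' - q) w_2 psi_2 + conj (q' - q) w_1 psi_1]; inserting
   [q' - q] brings out the factor [<w, Psi>]. *)
transitivity (- (2 * 'i * (z1 - cconj z1) * (Psi t).1 * (Psi t).2 /
  dot (Psi t) (Psi t)) * dot (w t) (Psi t)); last by rewrite dw mulr0.
rewrite cconj_q' q'E /=.
by move: n0; rewrite /dot/=; generalize_cconj => n0; field.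
Qed.

End Darboux.
End MaximalRelation.

(** * Square-integrable functions *)

Section SquareIntegrable.
Variable R : realType.
Local Notation C := R[i].
Local Notation mu := (@lebesgue_measure R).
Implicit Types (a b c z : C) (x : R) (F G : vfun R) (D : set R).

Lemma cmeas_add D (f g : R -> C) : cmeas D f -> cmeas D g -> cmeas D (fun x => f x + g x).
Proof.
move=> [f1 f2] [g1 g2]; split.
  rewrite (_ : reP _ = reP f \+ reP g); first exact: measurable_funD.
  by apply/funext => x; rewrite /reP Re_add.
rewrite (_ : imP _ = imP f \+ imP g); first exact: measurable_funD.
by apply/funext => x; rewrite /imP Im_add.
Qed.

Lemma cmeas_mul D (f g : R -> C) : cmeas D f -> cmeas D g -> cmeas D (fun x => f x * g x).
Proof.
move=> [f1 f2] [g1 g2]; split.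
  rewrite (_ : reP _ = (reP f \* reP g) \- (imP f \* imP g)).
    by apply: measurable_funB; exact: measurable_funM.
  by apply/funext => x; rewrite /reP Re_mul.
rewrite (_ : imP _ = (reP f \* imP g) \+ (imP f \* reP g)).
  by apply: measurable_funD; exact: measurable_funM.
by apply/funext => x; rewrite /imP Im_mul.
Qed.

Lemma cmeas_cst D c : cmeas D (fun=> c).
Proof. by split; exact: measurable_cst. Qed.

Lemma cmeas_conj D (f : R -> C) : cmeas D f -> cmeas D (fun x => cconj (f x)).
Proof. by move=> [f1 f2]; split => //; exact: measurable_funN. Qed.

Lemma cmeas_opp D (f : R -> C) : cmeas D f -> cmeas D (fun x => - f x).
Proof.
move=> [f1 f2]; split.
  rewrite (_ : reP _ = \- reP f); first exact: measurable_funN.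
  by apply/funext => x; rewrite /reP Re_opp.
rewrite (_ : imP _ = \- imP f); first exact: measurable_funN.
by apply/funext => x; rewrite /imP Im_opp.
Qed.

Definition vmeas D F := cmeas D (fun x => (F x).1) /\ cmeas D (fun x => (F x).2).

Lemma vmeas_vadd D F G : vmeas D F -> vmeas D G -> vmeas D (vadd F G).
Proof. by move=> [? ?] [? ?]; split; exact: cmeas_add. Qed.

Lemma vmeas_vscale D c F : vmeas D F -> vmeas D (vscale c F).
Proof. by move=> [? ?]; split; apply: cmeas_mul => //; exact: cmeas_cst. Qed.

Lemma vmeas_vkconj D F : vmeas D F -> vmeas D (vkconj F).
Proof. by move=> [? ?]; split => /=; [|apply: cmeas_opp]; exact: cmeas_conj. Qed.

Lemma vmeas_sigma3 D F : vmeas D F -> vmeas D (fun x => sigma3 (F x)).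
Proof. by move=> [? ?]; split => //=; exact: cmeas_opp. Qed.

Lemma vsubE F G : vsub F G = vadd F (vscale (-1) G).
Proof. by apply/funext => x; rewrite /vsub /vadd /vscale/= !mulN1r. Qed.

Lemma ACloc_vmeas D F : ACloc F -> vmeas D F.
Proof. by move=> [? ?]; split; exact: cAC_cmeas. Qed.

Lemma vsq_ge0 F x : 0 <= vsq F x.
Proof. exact: normsq_ge0. Qed.

Lemma csq_measurable D (f : R -> C) : cmeas D f -> measurable_fun D (fun x => csq (f x)).
Proof.
by move=> [f1 f2]; apply: measurable_funD; exact: measurable_funX.
Qed.

Lemma vsq_measurable D F : vmeas D F -> measurable_fun D (fun x => (vsq F x)%:E).
Proof.
move=> [f1 f2]; apply/measurable_EFinP.
by apply: measurable_funD; exact: csq_measurable.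
Qed.

Lemma L2on_vmeas D F : L2on D F -> vmeas D F.
Proof. by move=> [? []]. Qed.

(** Two majorants cover sums; multiples and projections take [K2 = 0]. *)
Lemma integral_vsq_le D (K1 K2 : R) F1 F2 G : measurable D ->
  0 <= K1 -> 0 <= K2 -> vmeas D F1 -> vmeas D F2 -> vmeas D G ->
  (forall x, D x -> vsq G x <= K1 * vsq F1 x + K2 * vsq F2 x) ->
  (\int[mu]_(x in D) (vsq G x)%:E <=
   K1%:E * \int[mu]_(x in D) (vsq F1 x)%:E + K2%:E * \int[mu]_(x in D) (vsq F2 x)%:E)%E.
Proof.
move=> mD K10 K20 m1 m2 mG le.
have v0 F x : (0 <= (vsq F x)%:E)%E by rewrite lee_fin vsq_ge0.
have mv F K : vmeas D F -> measurable_fun D (fun x => (K%:E * (vsq F x)%:E)%E).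
  by move=> mF; apply: measurable_funeM; exact: vsq_measurable.
rewrite -!ge0_integralZl//; try exact: vsq_measurable.
rewrite -ge0_integralD//; try by [exact: mv | move=> *; rewrite mule_ge0].
apply: ge0_le_integral => //; first exact: vsq_measurable.
by apply: emeasurable_funD; exact: mv.
Qed.

Lemma L2on_le D (K1 K2 : R) F1 F2 G : measurable D -> 0 <= K1 -> 0 <= K2 ->
  L2on D F1 -> L2on D F2 -> vmeas D G ->
  (forall x, D x -> vsq G x <= K1 * vsq F1 x + K2 * vsq F2 x) -> L2on D G.
Proof.
move=> mD K10 K20 [m1 [m1' i1]] [m2 [m2' i2]] mG le.
have [? ?] := mG; do !split => //.
apply: le_lt_trans (integral_vsq_le mD K10 K20 _ _ mG le) _ => //.
by rewrite lte_add_pinfty// lte_mul_pinfty// ?lee_fin.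
Qed.

Lemma l2norm_ge0 F : 0 <= l2norm F.
Proof. exact: sqrtr_ge0. Qed.

Lemma l2norm_sqr F : L2 F -> ((l2norm F ^+ 2)%:E = \int[mu]_x (vsq F x)%:E)%E.
Proof.
move=> [_ [_ fin]].
have ge0 : (0 <= \int[mu]_x (vsq F x)%:E)%E.
  by apply: integral_ge0 => x _; rewrite lee_fin vsq_ge0.
by rewrite /l2norm sqr_sqrtr ?fine_ge0// fineK// ge0_fin_numE.
Qed.

Lemma l2norm_le (K1 K2 : R) F1 F2 G : 0 <= K1 -> 0 <= K2 ->
  L2 F1 -> L2 F2 -> vmeas setT G ->
  (forall x, vsq G x <= K1 * vsq F1 x + K2 * vsq F2 x) ->
  L2 G /\ l2norm G ^+ 2 <= K1 * l2norm F1 ^+ 2 + K2 * l2norm F2 ^+ 2.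
Proof.
move=> K10 K20 L1 L2' mG le.
have LG : L2 G by exact: (L2on_le measurableT K10 K20 L1 L2' mG (fun x _ => le x)).
split => //; rewrite -lee_fin EFinD (EFinM K1) (EFinM K2) !l2norm_sqr//.
by apply: integral_vsq_le => //; exact: L2on_vmeas.
Qed.

(** A squared triangle inequality with factor 2 stands in for Minkowski: only boundedness and
    convergence to zero matter later. *)
Lemma L2_vadd F G : L2 F -> L2 G ->
  L2 (vadd F G) /\ l2norm (vadd F G) ^+ 2 <= 2 * l2norm F ^+ 2 + 2 * l2norm G ^+ 2.
Proof.
move=> LF LG; apply: l2norm_le => //.
  by apply: vmeas_vadd; exact: L2on_vmeas.
by move=> x; rewrite -mulrDr; exact: normsq_padd.
Qed.

Lemma l2norm_vscale c F : L2 F ->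
  L2 (vscale c F) /\ l2norm (vscale c F) ^+ 2 <= csq c * l2norm F ^+ 2.
Proof.
move=> LF; rewrite -[leRHS]addr0 -(mul0r (l2norm F ^+ 2)).
apply: l2norm_le => //; first exact: csq_ge0.
  by apply: vmeas_vscale; exact: L2on_vmeas.
by move=> x; rewrite mul0r addr0; have := normsq_pscale c (F x); rewrite /vsq/normsq/= => ->.
Qed.

Lemma l2norm_vscaleE c F : L2 F -> l2norm (vscale c F) ^+ 2 = csq c * l2norm F ^+ 2.
Proof.
move=> LF; have [LcF le1] := l2norm_vscale c LF; apply/eqP; rewrite eq_le le1/=.
have [->|c0] := eqVneq (csq c) 0; first by rewrite mul0r sqr_ge0.
have c0' : c != 0 by rewrite -csq_eq0.
have cpos : 0 < csq c by rewrite lt_neqAle eq_sym c0 csq_ge0.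
have [_] := l2norm_vscale c^-1 LcF.
have -> : vscale c^-1 (vscale c F) = F.
  by apply/funext => x; apply: pair_ext; rewrite /= mulKf.
by rewrite csqV mulrC ler_pdivlMr// mulrC.
Qed.

Lemma L2_vsub F G : L2 F -> L2 G ->
  L2 (vsub F G) /\ l2norm (vsub F G) ^+ 2 <= 2 * l2norm F ^+ 2 + 2 * l2norm G ^+ 2.
Proof.
move=> LF LG; have [LG' le] := l2norm_vscale (-1) LG; rewrite vsubE.
have [? le'] := L2_vadd LF LG'; split => //.
have c1 : csq (- 1 : C) = 1 by rewrite csqN /csq/= expr1n expr0n addr0.
by move: le le'; rewrite c1; lra.
Qed.

Definition vzero : vfun R := fun=> (0, 0).

Lemma vsq_vzero x : vsq vzero x = 0.
Proof. by rewrite /vsq/csq/= !expr0n/= !addr0. Qed.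

Lemma L2_vzero : L2 vzero.
Proof.
split; [exact: cmeas_cst|split; [exact: cmeas_cst|]].
by rewrite integral0_eq// => x _; rewrite vsq_vzero.
Qed.

Lemma l2norm_vzero : l2norm vzero = 0.
Proof. by rewrite /l2norm integral0_eq ?sqrtr0// => x _; rewrite vsq_vzero. Qed.

Lemma acloc_vsq F : ACloc F -> acloc (vsq F).
Proof.
move=> [/cACloc_acloc[f1 f2] /cACloc_acloc[f3 f4]].
apply: aclocP (aclocD (aclocD (aclocM f1 f1) (aclocM f2 f2))
                      (aclocD (aclocM f3 f3) (aclocM f4 f4))) _ => x.
by rewrite /vsq /csq !expr2.
Qed.

Lemma integral_vsq_gt (c r s : R) F D : measurable D -> vmeas D F -> r <= s ->
  `[r, s] `<=` D -> 0 <= c -> (forall x, r <= x -> x <= s -> c <= vsq F x) ->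
  ((c * (s - r))%:E <= \int[mu]_(x in D) (vsq F x)%:E)%E.
Proof.
move=> mD mF rs rsD c0 le.
have mv : measurable_fun D (fun x => (vsq F x)%:E) by exact: vsq_measurable.
apply: (@le_trans _ _ (\int[mu]_(x in `[r, s]) (vsq F x)%:E)%E); last first.
  by apply: ge0_subset_integral => // x _; rewrite lee_fin vsq_ge0.
have -> : ((c * (s - r))%:E = \int[mu]_(x in `[r, s]) (cst c%:E) x)%E.
  rewrite integral_cst//= lebesgue_measure_itv/= lte_fin EFinM.
  by move: rs; rewrite le_eqVlt => /orP[/eqP ->|-> //]; rewrite ltxx subrr.
apply: ge0_le_integral => //.
- by apply: measurable_funS mv.
- by move=> x /=; rewrite in_itv/= => /andP[? ?]; rewrite lee_fin le.
Qed.

(** By continuity |F|^2 stays above half its value at [x] on an interval of positive length. *)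
Lemma ACloc_l2norm_neq0 F x : ACloc F -> L2 F -> F x <> (0, 0) -> l2norm F != 0.
Proof.
move=> acF LF Fx0; have vx : 0 < vsq F x by exact: normsq_gt0.
clear Fx0; have : \forall y \near x, vsq F x / 2 < vsq F y.
  have cv := acloc_continuous (acloc_vsq acF) (x := x).
  apply: (cvgr_gt _ cv); lra.
move=> /nbhs_ballP[r /= r0 hr].
have : (((vsq F x / 2) * ((x + r / 2) - x))%:E <= \int[mu]_x (vsq F x)%:E)%E.
  apply: integral_vsq_gt => //; try lra; first exact: L2on_vmeas.
  move=> y xy yr; apply/ltW/hr; rewrite /ball/= ltr_norml; apply/andP; split; lra.
rewrite -l2norm_sqr// lee_fin => le.
apply: contraTneq le => ->; rewrite expr0n/= -ltNge.
by rewrite mulr_gt0//; lra.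
Qed.

Lemma ACloc_vadd F G : ACloc F -> ACloc G -> ACloc (vadd F G).
Proof. by move=> [? ?] [? ?]; split; exact: cAC_add. Qed.

Lemma ACloc_vscale c F : ACloc F -> ACloc (vscale c F).
Proof. by move=> [? ?]; split; apply: cAC_mul => //; exact: cAC_cst. Qed.

Lemma ACloc_vsub F G : ACloc F -> ACloc G -> ACloc (vsub F G).
Proof. by move=> *; rewrite vsubE; apply: ACloc_vadd => //; exact: ACloc_vscale. Qed.

Lemma ACloc_vkconj F : ACloc F -> ACloc (vkconj F).
Proof. by move=> [? ?]; split => /=; [|apply: cAC_opp]; exact: cAC_conj. Qed.

Section Projections.
Variable Psi : vfun R.
Hypothesis Psi0 : forall x, Psi x <> (0, 0).
Hypothesis acPsi : ACloc Psi.

Lemma cAC_invdot : cACloc (fun x => (dot (Psi x) (Psi x))^-1).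
Proof.
apply: (@cAC_inv_real _ (fun x => normsq (Psi x))).
- by move=> x; rewrite normsqE.
- exact: dotPsi0.
- by have [? ?] := acPsi; apply: cAC_add; apply: cAC_mul => //; exact: cAC_conj.
Qed.

Lemma ACloc_vproj F : ACloc F -> ACloc (vproj Psi F).
Proof.
move=> [F1 F2]; have [P1 P2] := acPsi.
have s : cACloc (fun x => dot (F x) (Psi x) / dot (Psi x) (Psi x)).
  apply: cAC_mul; last exact: cAC_invdot.
  by apply: cAC_add; apply: cAC_mul => //; exact: cAC_conj.
by split; apply: cAC_mul.
Qed.

Lemma vmeas_vproj D F : vmeas D F -> vmeas D (vproj Psi F).
Proof.
move=> [F1 F2]; have [P1 P2] := ACloc_vmeas D acPsi.
have s : cmeas D (fun x => dot (F x) (Psi x) / dot (Psi x) (Psi x)).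
  apply: cmeas_mul; last exact: cAC_cmeas cAC_invdot.
  by apply: cmeas_add; apply: cmeas_mul => //; exact: cmeas_conj.
by split; apply: cmeas_mul.
Qed.

Lemma vmeas_vsproj D F : vmeas D F -> vmeas D (vsproj Psi F).
Proof.
by move=> mF; apply: (@vmeas_sigma3 D (vproj Psi (fun x => sigma3 (F x))));
  apply: vmeas_vproj; exact: vmeas_sigma3.
Qed.

Lemma L2_vproj F : L2 F -> L2 (vproj Psi F) /\ l2norm (vproj Psi F) ^+ 2 <= l2norm F ^+ 2.
Proof.
move=> LF; have [||||? le] := @l2norm_le 1 0 F F (vproj Psi F) _ _ LF LF => //.
- by apply: vmeas_vproj; exact: L2on_vmeas.
- by move=> x; rewrite mul1r mul0r addr0; exact: normsq_proj.
- by split => //; move: le; rewrite mul1r mul0r addr0.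
Qed.

Lemma L2_vsproj F : L2 F -> L2 (vsproj Psi F) /\ l2norm (vsproj Psi F) ^+ 2 <= l2norm F ^+ 2.
Proof.
move=> LF; have [||||? le] := @l2norm_le 1 0 F F (vsproj Psi F) _ _ LF LF => //.
- by apply: vmeas_vsproj; exact: L2on_vmeas.
- by move=> x; rewrite mul1r mul0r addr0; exact: normsq_sproj.
- by split => //; move: le; rewrite mul1r mul0r addr0.
Qed.

End Projections.
End SquareIntegrable.

(** * Spectra under similarity *)

Section Spectra.
Variable R : realType.
Local Notation C := R[i].
Local Notation mu := (@lebesgue_measure R).
Implicit Types (q : R -> C) (a b c z : C) (x : R) (F G : vfun R).

Lemma csq_real (r : R) : csq r%:C%C = r ^+ 2.
Proof. by rewrite /csq/= expr0n addr0. Qed.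

Lemma DzEqP q z F G : DzEq q z F G <->
  [/\ L2 F, ACloc F, L2 G & Mrel q F (vadd G (vscale z F))].
Proof.
split=> [[[LF [acF _]] [LG M]]//|[LF acF LG M]].
do !split => //; exists (vadd G (vscale z F)); split => //.
by apply: (L2_vadd LG _).1; exact: (l2norm_vscale z LF).1.
Qed.

Lemma DzEq0P q z F : DzEq q z F (@vzero R) <->
  [/\ L2 F, ACloc F & Mrel q F (vscale z F)].
Proof.
have E : vadd (@vzero R) (vscale z F) = vscale z F.
  by apply/funext => x; apply: pair_ext; rewrite /= add0r.
rewrite DzEqP E; split=> [[]//|[? ? ?]]; split => //; exact: L2_vzero.
Qed.

(** Eigenvectors become solutions with zero right-hand side, the form in which a similarity carries
    them over. *)
Lemma point_spectrumP q z : point_spectrum q z <->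
  exists2 F, DzEq q z F (@vzero R) & l2norm F != 0.
Proof.
split=> [[F [[LF [acF _]] [F0 M]]]|[F /DzEq0P[LF acF M] F0]].
  by exists F => //; apply/DzEq0P.
exists F; split => //; do !split => //; exists (vscale z F); split => //.
exact: (l2norm_vscale z LF).1.
Qed.

Lemma DzEq_scale q z c F G : DzEq q z F G -> DzEq q z (vscale c F) (vscale c G).
Proof.
move=> /DzEqP[LF acF LG M]; apply/DzEqP; split.
- exact: (l2norm_vscale c LF).1.
- exact: ACloc_vscale.
- exact: (l2norm_vscale c LG).1.
- apply: Mrel_ext (Mrel_scale c M) => x; apply: pair_ext => /=; ring.
Qed.

Lemma point_spectrum_sub q : point_spectrum q `<=` spectrum q.
Proof.
move=> z /point_spectrumP[F DF F0] [_ [c hc]].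
move: (hc _ _ DF); rewrite l2norm_vzero mulr0 => le0.
by move: F0; rewrite eq_le le0 l2norm_ge0.
Qed.

Definition bounded_op (T : vfun R -> vfun R) :=
  (exists2 K : R, 0 <= K & forall F, L2 F -> L2 (T F) /\ l2norm (T F) <= K * l2norm F) /\
  forall F G, T (vsub F G) = vsub (T F) (T G).

Lemma bounded_op_vzero T : bounded_op T -> T (@vzero R) = @vzero R.
Proof.
move=> [_ Tsub]; have vv F : vsub F F = @vzero R.
  by apply/funext => x; apply: pair_ext; rewrite /= subrr.
by rewrite -[X in T X](vv (@vzero R)) Tsub vv.
Qed.

(** The relation [(D(q') - z) T = S (D(q) - z)] at a single [z]. [T] acts on functions and [S] on
    right-hand sides; they may differ and depend on [z], which still carries over solvability,
    kernels and singular sequences. *)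
Definition similar q q' z := exists T S T' S' : vfun R -> vfun R,
  [/\ [/\ bounded_op T, bounded_op S, bounded_op T' & bounded_op S'],
      (forall F G, DzEq q z F G -> DzEq q' z (T F) (S G)),
      (forall F G, DzEq q' z F G -> DzEq q z (T' F) (S' G)) &
      [/\ cancel T T', cancel T' T, cancel S S' & cancel S' S]].

Lemma similar_sym q q' z : similar q q' z -> similar q' q z.
Proof.
move=> [T [S [T' [S' [[? ? ? ?] h h' [? ? ? ?]]]]]].
by exists T', S', T, S; split.
Qed.

Lemma similar_resolvent q q' z : similar q q' z -> resolvent q z -> resolvent q' z.
Proof.
move=> [T [S [T' [S' [[[[K K0 bT] _] bS bT' [[K' K'0 bS'] _]] h h' [TT' T'T SS' S'S]]]]]].
move=> [surj [c hc]]; split.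
  move=> G LG; have [F DF] := surj (S' G) (bS' _ LG).1.
  by exists (T F); rewrite -(S'S G); exact: h.
(* The constant [c] in [resolvent] carries no sign, hence the absolute value. *)
exists (K * `|c| * K') => F G DFG; have [LF _ LG _] := (DzEqP _ _ _ _).1 DFG.
have D := h' _ _ DFG; have [LT'F _ _ _] := (DzEqP _ _ _ _).1 D.
rewrite -{1}(T'T F); apply: le_trans (bT _ LT'F).2 _.
rewrite -!mulrA; apply: ler_wpM2l => //; apply: le_trans (hc _ _ D) _.
apply: (@le_trans _ _ (`|c| * l2norm (S' G))).
  by apply: ler_wpM2r; [exact: l2norm_ge0|exact: ler_norm].
by apply: ler_wpM2l => //; exact: (bS' _ LG).2.
Qed.

Lemma similar_point_spectrum q q' z : similar q q' z ->
  point_spectrum q z -> point_spectrum q' z.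
Proof.
move=> [T [S [T' [S' [[bT bS [[K K0 bT'] _] _] h h' [TT' T'T SS' S'S]]]]]].
move=> /point_spectrumP[F DF F0]; apply/point_spectrumP; exists (T F).
  by rewrite -(bounded_op_vzero bS); exact: h.
have [LF _ _] := (DzEq0P _ _ _).1 DF.
have [LTF _ _ _] := (DzEqP _ _ _ _).1 (h _ _ DF).
apply: contraNneq F0 => T0; rewrite eq_le l2norm_ge0 andbT.
by have [_] := bT' _ LTF; rewrite TT' T0 mulr0.
Qed.

Definition subcvg (f : nat -> vfun R) :=
  exists phi : nat -> nat, {homo phi : m n / (m < n)%N >-> (m < n)%N} /\
    exists h, L2 h /\ (fun n => l2norm (vsub (f (phi n)) h)) @ \oo --> 0.

(* The negation of membership in the essential spectrum, freed from the
   normalisation of the Weyl sequence. *)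
Definition weyl_compact q z := forall (f g : nat -> vfun R) (B : R),
  (forall n, DzEq q z (f n) (g n)) -> (forall n, l2norm (f n) <= B) ->
  (fun n => l2norm (g n)) @ \oo --> 0 -> subcvg f.

Lemma bolzano_weierstrass_homo (u : nat -> R) (B : R) : (forall n, `|u n| <= B) ->
  exists2 phi : nat -> nat, {homo phi : m n / (m < n)%N >-> (m < n)%N} &
    exists l : R, (u \o phi) @ \oo --> l.
Proof.
move=> uB; have [|phi incr cv] := @bolzano_weierstrass R u.
  exists B; split; first exact: num_real.
  by move=> M BM n _; apply: le_trans (uB n) (ltW BM).
exists phi; last by exists (lim ((u \o phi) @ \oo)).
by move=> m n mn; have := incr n m; rewrite leEnat [RHS]leqNgt mn ltnNge => ->.
Qed.

Lemma cvg_homo (u : nat -> R) (phi : nat -> nat) (l : R) :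
  {homo phi : m n / (m < n)%N >-> (m < n)%N} ->
  u @ \oo --> l -> (u \o phi) @ \oo --> l.
Proof.
move=> incr cu; apply: (cvg_comp phi u _ cu).
apply: (@cvg_trans _ (id n @[n --> \oo])); last exact: cvg_id.
move=> A [N _ NA]; exists N => // n /= Nn; apply: NA => /=.
apply: leq_trans Nn _; elim: n => // n IH.
exact: leq_ltn_trans IH (incr _ _ (ltnSn n)).
Qed.

Lemma cvg0_squeeze (u e : nat -> R) : (forall n, 0 <= u n) ->
  (forall n, u n ^+ 2 <= e n) -> e @ \oo --> 0 -> u @ \oo --> 0.
Proof.
move=> u0 ue ce; apply/cvgr0Pnorm_lt => eps eps0.
have e20 : 0 < eps ^+ 2 by rewrite exprn_gt0.
near=> n; rewrite ger0_norm// -(@ltr_pXn2r _ 2)//= ?nnegrE ?u0 ?ltW//.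
apply: le_lt_trans (ue n) _; apply: le_lt_trans (ler_norm _) _.
by near: n; exact: (cvgr0_norm_lt _ ce).
Unshelve. all: by end_near. Qed.

Lemma cvg0_sqr (a b : R) (u v : nat -> R) : u @ \oo --> 0 -> v @ \oo --> 0 ->
  (fun n => a * u n ^+ 2 + b * v n ^+ 2) @ \oo --> 0.
Proof.
move=> cu cv; have -> : 0 = a * (0 * 0) + b * (0 * 0) by rewrite !mulr0 addr0.
under eq_fun do rewrite !expr2.
by apply: cvgD; apply: cvgMl_tmp; exact: cvgM.
Qed.

Lemma bounded_op_cvg0 T (u : nat -> vfun R) : bounded_op T ->
  (forall n, L2 (u n)) -> (fun n => l2norm (u n)) @ \oo --> 0 ->
  (fun n => l2norm (T (u n))) @ \oo --> 0.
Proof.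
move=> [[K K0 bT] _] Lu cu.
apply: (squeeze_cvgr (f := fun=> 0) (h := fun n => K * l2norm (u n))).
- by near=> n; rewrite l2norm_ge0 (bT _ (Lu n)).2.
- exact: cvg_cst.
- by rewrite -(mulr0 K); exact: cvgMr.
Unshelve. all: by end_near. Qed.

Lemma similar_weyl_compact q q' z : similar q q' z ->
  weyl_compact q z -> weyl_compact q' z.
Proof.
move=> [T [S [T' [S' [[bT bS bT' bS'] h h' [TT' T'T SS' S'S]]]]]].
move=> Wq f g B Dfg fB g0.
have Lf n : L2 (f n) by have [] := (DzEqP _ _ _ _).1 (Dfg n).
have Lg n : L2 (g n) by have [] := (DzEqP _ _ _ _).1 (Dfg n).
have [[K K0 hT'] T'sub] := bT'.
have [||phi [incr [l [Ll cl]]]] := Wq (T' \o f) (S' \o g) (K * B) (fun n => h' _ _ (Dfg n)).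
- by move=> n; apply: le_trans (hT' _ (Lf n)).2 _; exact: ler_wpM2l.
- exact: bounded_op_cvg0.
exists phi; split => //; exists (T l); split.
  by have [[K1 _ hT] _] := bT; exact: (hT _ Ll).1.
have := bounded_op_cvg0 bT (fun n => (L2_vsub (hT' _ (Lf (phi n))).1 Ll).1) cl.
by under eq_fun do rewrite bT.2 T'T.
Qed.

(** The work lies in normalising: a bounded sequence without convergent subsequence has norms
    tending to some [t > 0] along a subsequence, and a limit of the normalised terms, multiplied by
    [t], would be a limit of the original ones. *)
Lemma ess_spectrumP q z : ess_spectrum q z <-> ~ weyl_compact q z.
Proof.
split=> [[f [g [Dfg [nc g0]]]] W|nW].
  apply: nc; apply: (W f g 1) => // n; first by have [] := Dfg n.
  by have [_ ->] := Dfg n.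
apply: contrapT => nE; apply: nW => f g B Dfg fB g0.
apply: contrapT => nc.
have Lf n : L2 (f n) by have [] := (DzEqP _ _ _ _).1 (Dfg n).
have Lg n : L2 (g n) by have [] := (DzEqP _ _ _ _).1 (Dfg n).
have [|phi incr [t ct]] := @bolzano_weierstrass_homo (fun n => l2norm (f n)) B.
  by move=> n; rewrite ger0_norm ?l2norm_ge0.
have t0 : 0 <= t.
  by apply: (cvgr_to_ge ct); near=> n; exact: l2norm_ge0.
(* For [t = 0] the subsequence itself converges, to zero. *)
have [t00|tneq0] := eqVneq t 0.
  apply: nc; exists phi; split => //; exists (@vzero R); split; first exact: L2_vzero.
  rewrite t00 in ct; apply: cvg_trans ct; apply: near_eq_cvg; near=> n.
  by congr l2norm; apply/funext => x; apply: pair_ext; rewrite /= subr0.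
have tpos : 0 < t by rewrite lt_neqAle eq_sym tneq0.
have [N _ hN] : \forall n \near \oo, t / 2 < l2norm (f (phi n)).
  by apply: (cvgr_gt _ ct); lra.
(* Dropping [N] terms makes [s n > t / 2] for every [n]: each member of a singular sequence must be
   normalised, not just almost all. *)
pose psi n := phi (n + N)%N; pose s n := l2norm (f (psi n)).
have psi_incr : {homo psi : m n / (m < n)%N >-> (m < n)%N}.
  by move=> m n mn; apply: incr; rewrite ltn_add2r.
have cs : s @ \oo --> t.
  by move: ct; rewrite -(cvg_shiftn N).
have st n : t / 2 < s n by apply: hN; rewrite /= leq_addl.
have s0 n : 0 < s n by apply: le_lt_trans (st n); lra.
pose f' n := vscale ((s n)^-1)%:C%C (f (psi n)).
pose g' n := vscale ((s n)^-1)%:C%C (g (psi n)).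
apply: nE; exists f', g'; split; [|split].
- move=> n; split; first exact: DzEq_scale.
  apply/eqP; rewrite -(@eqrXn2 _ 2)// ?l2norm_ge0// l2norm_vscaleE// csq_real.
  by rewrite -/(s n) -exprMn mulVf// lt0r_neq0.
- move=> [chi [chi_incr [h [Lh ch]]]]; apply: nc; exists (psi \o chi); split.
    by move=> m n mn; apply/psi_incr/chi_incr.
  exists (vscale t%:C%C h); split; first exact: (l2norm_vscale _ Lh).1.
  have Lf' n : L2 (f' n) by exact: (l2norm_vscale _ (Lf _)).1.
  (* From [f - t h = s (f' - h) + (s - t) h] and [s <= B]. *)
  apply: (@cvg0_squeeze _ (fun n => (2 * B ^+ 2) * l2norm (vsub (f' (chi n)) h) ^+ 2 +
     (2 * l2norm h ^+ 2) * (s (chi n) - t) ^+ 2)).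
  + by move=> n; exact: l2norm_ge0.
  + move=> n; have [Ld _] := L2_vsub (Lf' (chi n)) Lh.
    have -> : vsub (f ((psi \o chi) n)) (vscale t%:C%C h) =
        vadd (vscale (s (chi n))%:C%C (vsub (f' (chi n)) h))
             (vscale (s (chi n) - t)%:C%C h).
      have sn : (s (chi n))%:C%C != 0 :> C.
        by rewrite -(rmorph0 (real_complex R)) (inj_eq (@complexI R)) gt_eqF.
      apply/funext => x; apply: pair_ext; rewrite /= rmorphB fmorphV/=.
        by field.
      by field.
    have [La la] := l2norm_vscale (s (chi n))%:C%C Ld.
    have [Lb lb] := l2norm_vscale (s (chi n) - t)%:C%C Lh.
    apply: le_trans (L2_vadd La Lb).2 _; rewrite !csq_real in la lb.
    apply: lerD; last by rewrite -mulrA (mulrC (l2norm h ^+ 2)); exact: ler_wpM2l.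
    rewrite -mulrA; apply: ler_wpM2l => //; apply: le_trans la _.
    apply: ler_wpM2r; first exact: sqr_ge0.
    have B0 : 0 <= B := le_trans (l2norm_ge0 _) (fB 0%N).
    by rewrite ler_pXn2r ?nnegrE ?l2norm_ge0//; exact: fB.
  + have cst2 : (fun n => s (chi n) - t) @ \oo --> 0.
      by rewrite -(subrr t); apply: cvgB; [exact: (cvg_homo chi_incr cs)|exact: cvg_cst].
    exact: cvg0_sqr.
- apply: (@cvg0_squeeze _ (fun n => (2 / t) ^+ 2 * l2norm (g (psi n)) ^+ 2)).
  + by move=> n; exact: l2norm_ge0.
  + move=> n; rewrite l2norm_vscaleE// csq_real; apply: ler_wpM2r; first exact: sqr_ge0.
    have le : (s n)^-1 <= 2 / t.
      by rewrite -(invf_div t) lef_pV2 ?posrE ?divr_gt0//; exact: ltW.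
    by rewrite ler_pXn2r ?nnegrE ?invr_ge0 ?divr_ge0//; exact: ltW.
  + have cg := cvg_homo psi_incr g0.
    have := cvg0_sqr ((2 / t) ^+ 2) 0 cg cg.
    by under eq_fun do rewrite mul0r addr0.
Unshelve. all: by end_near. Qed.

End Spectra.

(** * Wave functions and symmetries *)

Section Waves.
Variable R : realType.
Local Notation C := R[i].
Local Notation mu := (@lebesgue_measure R).
Implicit Types (q : R -> C) (a b c z : C) (x : R) (F G : vfun R).

(** The potential enters the system through a skew-Hermitian matrix, so it drops out of the
    derivative of |F|^2 and no bound on [q] is needed for growth estimates. *)
Lemma vsq_derive q z F x : Mrel_at q F (vscale z F) x ->
  is_derive x 1 (vsq F) (2 * complex.Im z * (csq (F x).1 - csq (F x).2)).
Proof.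
move=> [d1 d2].
have [+ _] := (has_cderivP _ _ _).1 (has_cderiv_add (has_cderiv_mul d1 (has_cderiv_conj d1)) (has_cderiv_mul d2 (has_cderiv_conj d2))).
rewrite (_ : reP _ = vsq F); last first.
  by apply/funext => y; rewrite /reP /vsq -!csqE.
move/is_derive_eq; apply.
rewrite /csq !ReImE/= !ReImE/=; ring.
Qed.

Lemma csqB_le (K : R) (u v k : R) : 0 <= u -> 0 <= v -> `|k| <= K ->
  `|2 * k * (u - v)| <= 2 * K * (u + v).
Proof.
move=> u0 v0; rewrite !ler_norml => /andP[? ?]; apply/andP; split; nra.
Qed.

(* |F|^2 exp(-kx) decreases and |F|^2 exp(kx) increases for k = 2|Im z|: the
   potential cancels out of the derivative of |F|^2. *)
Lemma wave_unique q z F x0 : ACloc F -> Mrel q F (vscale z F) ->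
  F x0 = (0, 0) -> forall x, F x = (0, 0).
Proof.
move=> acF /MrelP MF F0; set k := 2 * `|complex.Im z|.
have v0 : vsq F x0 = 0 by rewrite /vsq F0 /csq/= !expr0n/= !addr0.
have bnd x : Mrel_at q F (vscale z F) x ->
    `|2 * complex.Im z * (csq (F x).1 - csq (F x).2)| <= k * vsq F x.
  by move=> _; apply: csqB_le; rewrite ?csq_ge0.
have de (l : R) x : is_derive x 1 (fun y => expR (l * y)) (l * expR (l * x)).
  by apply: is_derive_eq; rewrite /GRing.scale/=; ring.
suff v x : vsq F x <= 0.
  by move=> x; apply/eqP; rewrite -normsq_eq0 eq_le normsq_ge0 andbT; exact: v.
have acv := acloc_vsq acF.
have [x0x|/ltW xx0] := leP x0 x.
  have ac := aclocM acv (acloc_expR (- k)).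
  have := @acloc_nonincreasing _ _ ac _ x0 x x0x; rewrite v0 mul0r => h.
  rewrite -(@pmulr_lle0 _ (expR (- k * x))) ?expR_gt0// h//.
  apply: ae_imp MF => t D; have dv := vsq_derive D; have de' := de (- k) t.
  have [dd ee] : is_derive t 1 (fun x => vsq F x * expR (- k * x))
     ((2 * complex.Im z * (csq (F t).1 - csq (F t).2) - k * vsq F t) * expR (- k * t)).
    have dm := is_deriveM dv de'; apply: (is_derive_eq dm).
    by rewrite /GRing.scale/=; ring.
  split => //; rewrite derive1E ee pmulr_lle0 ?expR_gt0// subr_le0.
  exact: le_trans (ler_norm _) (bnd _ D).
have ac := aclocN (aclocM acv (acloc_expR k)).
have := @acloc_nonincreasing _ _ ac _ x x0 xx0; rewrite v0 mul0r oppr0 => h.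
rewrite -(@pmulr_lle0 _ (expR (k * x))) ?expR_gt0// -oppr_ge0 h//.
apply: ae_imp MF => t D; have dv := vsq_derive D; have de' := de k t.
have [dd ee] : is_derive t 1 (fun x => - (vsq F x * expR (k * x)))
   (- (2 * complex.Im z * (csq (F t).1 - csq (F t).2) + k * vsq F t) * expR (k * t)).
  have dm := is_deriveN (is_deriveM dv de'); apply: (is_derive_eq dm).
  by rewrite /GRing.scale/=; ring.
split => //; rewrite derive1E ee pmulr_lle0 ?expR_gt0// oppr_le0 -lerBlDr sub0r.
have := bnd _ D; rewrite ler_norml => /andP[+ _]; exact.
Qed.

Definition wronskian F G x := (F x).1 * (G x).2 - (F x).2 * (G x).1.

(** The coefficient matrix of the first-order system has trace zero. *)
Lemma wronskian_const q z F G : ACloc F -> ACloc G ->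
  Mrel q F (vscale z F) -> Mrel q G (vscale z G) ->
  forall x y, wronskian F G x = wronskian F G y.
Proof.
move=> [F1 F2] [G1 G2] /MrelP MF /MrelP MG; apply: cAC_const.
  by apply: cAC_add; [|apply: cAC_opp]; exact: cAC_mul.
apply: ae_imp2 MF MG => x [f1 f2] [g1 g2].
have := has_cderiv_add (has_cderiv_mul f1 g2) (has_cderiv_opp (has_cderiv_mul f2 g1)); congr has_cderiv.
by rewrite /=; generalize_cconj; ring.
Qed.

(** By uniqueness [G 0] is nonzero. Take [a] to be the coefficient of the projection of [F 0] onto
    [G 0]: the vanishing Wronskian makes [F - a G] zero at 0, hence everywhere. *)
Lemma wronskian_colinear q z F G : ACloc F -> ACloc G ->
  Mrel q F (vscale z F) -> Mrel q G (vscale z G) -> (exists x, G x <> (0, 0)) ->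
  wronskian F G 0 = 0 -> exists a, F = vscale a G.
Proof.
move=> acF acG MF MG [x1 Gx1] W0.
have G0 : dot (G 0) (G 0) != 0.
  rewrite dot_eq0; apply/eqP => G0; apply: Gx1; exact: wave_unique acG MG G0 x1.
pose a := dot (F 0) (G 0) / dot (G 0) (G 0); exists a.
have := Mrel_lin 1 (- a) MF MG.
move=> /(@Mrel_ext _ _ _ _ (vscale z (vadd (vscale 1 F) (vscale (- a) G)))) M.
have acD : ACloc (vadd (vscale 1 F) (vscale (- a) G)).
  by apply: ACloc_vadd; exact: ACloc_vscale.
have D0 : vadd (vscale 1 F) (vscale (- a) G) 0 = (0, 0).
  apply: pair_ext => /=; apply: (mulIf G0); rewrite mul0r mul1r mulrDl mulNr mulNr.
    rewrite mulrAC /a divfK//.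
    transitivity (cconj (G 0).2 * wronskian F G 0); last by rewrite W0 mulr0.
    by rewrite /wronskian /dot; generalize_cconj; ring.
  rewrite mulrAC /a divfK//.
  transitivity (- cconj (G 0).1 * wronskian F G 0); last by rewrite W0 mulr0.
  by rewrite /wronskian /dot; generalize_cconj; ring.
have E x : vadd (vscale 1 F) (vscale (- a) G) x = (0, 0).
  apply: (wave_unique acD _ D0); apply: M => t.
  by apply: pair_ext => /=; ring.
apply/funext => x; have [e1 e2] := E x; apply: pair_ext => /=.
  by move/eqP: e1; rewrite mul1r mulNr subr_eq0 => /eqP.
by move/eqP: e2; rewrite mul1r mulNr subr_eq0 => /eqP.
Qed.

Lemma L2_halves F : ACloc F -> L2on `]-oo, 0] F -> L2on `[0, +oo[ F -> L2 F.
Proof.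
move=> acF [_ [_ i1]] [_ [_ i2]]; have [m1 m2] := ACloc_vmeas setT acF.
do !split => //; try by [case: m1|case: m2].
have U : setT = `]-oo, 0] `|` `]0, +oo[%classic :> set R.
  apply/seteqP; split => x //= _; rewrite !in_itv/= andbT.
  by case: (leP x 0) => ?; [left|right].
have mv D : measurable_fun D (fun x => (vsq F x)%:E).
  by apply: vsq_measurable; exact: ACloc_vmeas.
have v0 x : (0 <= (vsq F x)%:E)%E by rewrite lee_fin vsq_ge0.
rewrite U ge0_integral_setU//; last first.
  rewrite disj_set2E; apply/eqP/seteqP; split => // x [] /=; rewrite !in_itv/= andbT.
  by move=> /le_lt_trans/[apply]; rewrite ltxx.
  exact: mv.
apply: lte_add_pinfty => //; apply: le_lt_trans i2.
apply: ge0_subset_integral => //; first exact: mv.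
by move=> x /=; rewrite !in_itv/= !andbT => /ltW.
Qed.

(** Here the whole sequence tends to zero, by the resolvent bound. *)
Lemma resolvent_weyl_compact q z : resolvent q z -> weyl_compact q z.
Proof.
move=> [_ [c hc]] f g B Dfg _ g0; exists id; split => //.
exists (@vzero R); split; first exact: L2_vzero.
have -> : (fun n => l2norm (vsub (f (id n)) (@vzero R))) = (fun n => l2norm (f n)).
  by apply/funext => n; congr l2norm; apply/funext => x; apply: pair_ext; rewrite /= subr0.
apply: (squeeze_cvgr (f := fun=> 0) (h := fun n => c * l2norm (g n))).
- by near=> n; rewrite l2norm_ge0 hc.
- exact: cvg_cst.
- by rewrite -(mulr0 c); exact: cvgMl_tmp.
Unshelve. all: by end_near. Qed.

Lemma l2norm_vkconj F : l2norm (vkconj F) = l2norm F.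
Proof.
rewrite /l2norm; congr (Num.sqrt (fine _)).
by apply: eq_integral => x _; congr EFin; exact: normsq_kconj.
Qed.

Lemma L2_vkconj F : L2 F -> L2 (vkconj F).
Proof.
move=> LF; have [||||//] := @l2norm_le _ 1 0 F F (vkconj F) _ _ LF LF => //.
- by apply: vmeas_vkconj; exact: L2on_vmeas.
- by move=> x; rewrite mul1r mul0r addr0 le_eqVlt; apply/orP; left; apply/eqP; exact: normsq_kconj.
Qed.

Lemma vkconjK F : vkconj (vkconj F) = vscale (-1) F.
Proof. by apply/funext => x; apply: pair_ext; rewrite /= ?cconjN cconjK mulN1r. Qed.

Lemma vscaleN1K F : vscale (-1) (vscale (-1) F) = F.
Proof. by apply/funext => x; apply: pair_ext; rewrite /= !mulN1r opprK. Qed.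

Lemma vkconj_scaleN1 F : vkconj (vscale (-1) F) = vscale (-1) (vkconj F).
Proof. by apply/funext => x; apply: pair_ext; rewrite /= !mulN1r !cconjN. Qed.

Lemma vkconj_vsub F G : vkconj (vsub F G) = vsub (vkconj F) (vkconj G).
Proof. by apply/funext => x; apply: pair_ext; rewrite /= !cconjD !cconjN// opprD. Qed.

Lemma DzEq_vkconj q z F G : DzEq q z F G -> DzEq q (cconj z) (vkconj F) (vkconj G).
Proof.
move=> /DzEqP[LF acF LG M]; apply/DzEqP; split; [exact: L2_vkconj|exact: ACloc_vkconj|exact: L2_vkconj|].
apply: Mrel_ext (Mrel_vkconj M) => x; apply: pair_ext => /=; rewrite cconjD cconjM//.
by generalize_cconj; ring.
Qed.

Lemma point_spectrum_conj q z : point_spectrum q z -> point_spectrum q (cconj z).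
Proof.
move=> /point_spectrumP[F DF F0]; apply/point_spectrumP; exists (vkconj F).
  suff <- : vkconj (@vzero R) = @vzero R by exact: DzEq_vkconj.
  by apply/funext => x; apply: pair_ext; apply: complex_ext; rewrite /= ?oppr0.
by rewrite l2norm_vkconj.
Qed.

Lemma weyl_compact_conj q z : weyl_compact q z -> weyl_compact q (cconj z).
Proof.
move=> W f g B Dfg fB g0.
have [|||phi [incr [h [Lh ch]]]] := W (fun n => vkconj (f n)) (fun n => vkconj (g n)) B.
- by move=> n; rewrite -(cconjK z); exact: DzEq_vkconj.
- by move=> n; rewrite l2norm_vkconj.
- by under eq_fun do rewrite l2norm_vkconj.
(* K squared is -1, so a limit [h] of [K f_n] pulls back to [- K h]. *)
exists phi; split => //; exists (vscale (-1) (vkconj h)); split.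
  by apply: (l2norm_vscale _ _).1; exact: L2_vkconj.
suff -> : (fun n => l2norm (vsub (f (phi n)) (vscale (-1) (vkconj h)))) =
  (fun n => l2norm (vsub (vkconj (f (phi n))) h)) by [].
by apply/funext => n; rewrite -l2norm_vkconj vkconj_vsub vkconj_scaleN1 vkconjK vscaleN1K.
Qed.

End Waves.

(** * Spectra of the transformed operator *)

(** All variables but [d] and [cc] are squared norms: of [g], [S g], [p = P f], [S p], [g - S g],
    [S p - p] and the right-hand side [k] of the correction. [cc] is the squared resolvent bound and
    [d] is |conj z1 - z1|^2. *)
Lemma rhs_bound (R : realDomainType) (d cc g sg p sp gsg spp k : R) : 0 <= d -> 0 <= cc ->
  sg <= g -> p <= cc * sg -> sp <= p -> gsg <= 2 * g + 2 * sg ->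
  spp <= 2 * sp + 2 * p -> k <= 2 * gsg + 2 * (d * spp) ->
  k <= (8 + 2 * (d * (4 * cc))) * g.
Proof.
move=> d0 cc0 sgg psg spp1 h1 h2 h3.
have h4 : cc * sg <= cc * g by exact: ler_wpM2l.
have h5 : d * spp <= d * (4 * cc * g) by apply: ler_wpM2l => //; lra.
lra.
Qed.

(** Same conventions, with [F] the resolvent of D(q) applied to [k], [v = F - P F] and [r = p + v]:
    [v] contributes [2 * 4 * cc * K] and [p] contributes [2 * cc]. *)
Lemma remainder_bound (R : realDomainType) (cc K g sg p F PF k v r : R) : 0 <= cc ->
  sg <= g -> p <= cc * sg -> PF <= F -> F <= cc * k -> k <= K * g ->
  v <= 2 * F + 2 * PF -> r <= 2 * p + 2 * v -> r <= (2 * cc + 8 * (cc * K)) * g.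
Proof.
move=> cc0 sgg psg PFF Fk kg vF rp.
have h4 : cc * sg <= cc * g by exact: ler_wpM2l.
have h5 : cc * k <= cc * (K * g) by exact: ler_wpM2l.
lra.
Qed.

(** * Pointwise identities at the base point [z1] *)

Section ResolventIdentities.
Variable R : realType.
Local Notation C := R[i].
Variables P S : C * C -> C * C.
Hypotheses (Ppa : forall u v, P (padd u v) = padd (P u) (P v))
  (Pps : forall c u, P (pscale c u) = pscale c (P u))
  (Spa : forall u v, S (padd u v) = padd (S u) (S v))
  (Sps : forall c u, S (pscale c u) = pscale c (S u)).
Variables (z1 c : C).

(** This says [(M(q) - z1) P f = S g], which puts [P f] under the resolvent bound of D(q). *)
Lemma project_identity u v : S (S u) = S u ->
  let w := padd (padd v (pscale z1 u)) (pscale (c - z1) (padd (S u) (pscale (-1) (P u)))) in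
  padd (padd (S w) (pscale (- c) (S u))) (padd (pscale z1 (P u)) (pscale (c - z1) (S (P u)))) =
  padd (S v) (pscale z1 (P u)).
Proof.
move=> SS w; rewrite /w !(Spa, Sps) SS.
by apply: pair_ext; rewrite /=; ring.
Qed.

(** Computes the right-hand side [k] of the equation for [q'] that the complement [f - P f]
    satisfies; it involves only [g] and [P f], both already controlled. *)
Lemma complement_identity u v : P (P u) = P u ->
  let p := P u in
  let k := padd (padd v (pscale (-1) (S v))) (pscale (c - z1) (padd (S p) (pscale (-1) p))) in
  padd (pscale 1 (padd v (pscale z1 u)))
    (pscale (-1) (padd (padd (S v) (pscale z1 p)) (pscale (z1 - c) (padd (S p) (pscale (-1) (P p)))))) =
  padd k (pscale z1 (padd (pscale 1 u) (pscale (-1) p))).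
Proof.
move=> PP p k; rewrite /k /p PP; apply: pair_ext; rewrite /=; ring.
Qed.

(** The compatibility condition [S k = 0], without which [k] could not be reached from the
    complement of [P]. *)
Lemma rhs_identity p v : S (S p) = S p -> S (S v) = S v ->
  S (padd (padd v (pscale (-1) (S v))) (pscale (c - z1) (padd (S p) (pscale (-1) p)))) = (0, 0).
Proof.
move=> Sp Sv; rewrite !(Spa, Sps) Sp Sv.
by apply: pair_ext; rewrite /=; ring.
Qed.

(** At [z = z1] the intertwining relation, freed from the factor [z1 - c], reads [(M(q') - z1) (1 -
    P) = (1 - S) (M(q) - z1)], and [(1 - S) k = k]. *)
Lemma corrector_identity u k : P (P u) = P u -> S k = (0, 0) ->
  let v := padd (pscale 1 u) (pscale (-1) (P u)) in
  let w := padd k (pscale z1 u) in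
  padd (padd (pscale 1 w) (pscale (-1)
       (padd (padd (S w) (pscale (- c) (S u))) (padd (pscale z1 (P u)) (pscale (c - z1) (S (P u)))))))
     (pscale (z1 - c) (padd (S v) (pscale (-1) (P v)))) =
  padd k (pscale z1 v).
Proof.
move=> PP Sk v w; rewrite /v /w !(Ppa, Spa, Pps, Sps) PP Sk.
by apply: pair_ext; rewrite /=; ring.
Qed.

End ResolventIdentities.

(** * Similarity away from [z1] and [conj z1], and solutions at [z1] *)

Section DarbouxSpectra.
Variable R : realType.
Local Notation C := R[i].
Local Notation mu := (@lebesgue_measure R).
Variables (q q' : R -> C) (z1 : C) (Psi : vfun R).
Hypothesis Psi0 : forall x, Psi x <> (0, 0).
Hypothesis acPsi : ACloc Psi.
Hypothesis q'E : forall x, q' x = q x -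
  2 * 'i * (z1 - cconj z1) * (Psi x).1 * cconj (Psi x).2 / dot (Psi x) (Psi x).
Hypothesis MPsi : Mrel q Psi (vscale z1 Psi).
Implicit Types (a b z : C) (x : R) (F G : vfun R).

Lemma bounded_op_lin (V : vfun R -> vfun R) a b :
  (forall F, L2 F -> L2 (V F) /\ l2norm (V F) ^+ 2 <= l2norm F ^+ 2) ->
  (forall F G, V (vsub F G) = vsub (V F) (V G)) ->
  bounded_op (fun F => vadd (vscale a F) (vscale b (V F))).
Proof.
move=> LV subV; split; last first.
  by move=> F G; rewrite subV; apply/funext => x; apply: pair_ext => /=; ring.
exists (Num.sqrt (2 * (csq a + csq b))); first exact: sqrtr_ge0.
move=> F LF; have [LVF le] := LV F LF.
have [La la] := l2norm_vscale a LF; have [Lb lb] := l2norm_vscale b LVF.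
have [L l] := L2_vadd La Lb; split => //.
have K0 : 0 <= 2 * (csq a + csq b) by rewrite mulr_ge0// addr_ge0// csq_ge0.
rewrite -ler_sqr ?nnegrE ?mulr_ge0 ?sqrtr_ge0 ?l2norm_ge0//.
rewrite exprMn (sqr_sqrtr K0). apply: le_trans l _.
have : csq b * l2norm (V F) ^+ 2 <= csq b * l2norm F ^+ 2.
  by apply: ler_wpM2l => //; exact: csq_ge0.
by move: la lb; lra.
Qed.

Lemma vproj_vsub F G : vproj Psi (vsub F G) = vsub (vproj Psi F) (vproj Psi G).
Proof.
apply/funext => x; rewrite /vproj !vsubE.
rewrite -[vadd F _ x]/(padd (F x) (pscale (-1) (G x))).
by rewrite proj_padd (proj_pscale (Psi x) (-1) (G x)).
Qed.

Lemma vsproj_vsub F G : vsproj Psi (vsub F G) = vsub (vsproj Psi F) (vsproj Psi G).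
Proof.
apply/funext => x; rewrite /vsproj !vsubE.
rewrite -[vadd F _ x]/(padd (F x) (pscale (-1) (G x))).
by rewrite sproj_padd (sproj_pscale (Psi x) (-1) (G x)).
Qed.

Lemma bounded_op_dress a b : bounded_op (dress Psi a b).
Proof. by apply: bounded_op_lin; [exact: L2_vproj|exact: vproj_vsub]. Qed.

Lemma bounded_op_sdress a b : bounded_op (sdress Psi a b).
Proof. by apply: bounded_op_lin; [exact: L2_vsproj|exact: vsproj_vsub]. Qed.

(** As [P] is idempotent, the product of [a + b P] and [a' + b' P] is
    [a a' + (a b' + b a' + b b') P]; likewise for [S]. *)
Lemma dressK a b a' b' : a * a' = 1 -> a * b' + b * a' + b * b' = 0 ->
  cancel (dress Psi a b) (dress Psi a' b') /\ cancel (sdress Psi a b) (sdress Psi a' b').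
Proof.
move=> aa ab.
have E (P : C * C -> C * C) u : (forall u v, P (padd u v) = padd (P u) (P v)) ->
    (forall c u, P (pscale c u) = pscale c (P u)) -> P (P u) = P u ->
    padd (pscale a' (padd (pscale a u) (pscale b (P u)))) (pscale b' (P (padd (pscale a u) (pscale b (P u))))) = u.
  move=> Ppa Pps PP; rewrite !(Ppa, Pps) PP.
  rewrite -[RHS](_ : padd (pscale (a * a') u) (pscale (a * b' + b * a' + b * b') (P u)) = u).
    by apply: pair_ext; rewrite /=; ring.
  by rewrite aa ab; apply: pair_ext; rewrite /= mul1r mul0r addr0.
split=> F; apply/funext => x.
  exact: E (proj_padd _) (proj_pscale _) (proj_idem _ (@Psi0 x)).
exact: E (sproj_padd _) (sproj_pscale _) (sproj_idem _ (@Psi0 x)).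
Qed.

Lemma ACloc_dress a b F : ACloc F -> ACloc (dress Psi a b F).
Proof.
by move=> acF; apply: ACloc_vadd; apply: ACloc_vscale => //; exact: ACloc_vproj.
Qed.

Lemma DzEq_dress z F G : DzEq q z F G ->
  DzEq q' z (dress Psi (z - cconj z1) (cconj z1 - z1) F)
            (sdress Psi (z - cconj z1) (cconj z1 - z1) G).
Proof.
move=> /DzEqP[LF acF LG M]; apply/DzEqP; split.
- by have [[? _ h] _] := bounded_op_dress (z - cconj z1) (cconj z1 - z1); exact: (h _ LF).1.
- exact: ACloc_dress.
- by have [[? _ h] _] := bounded_op_sdress (z - cconj z1) (cconj z1 - z1); exact: (h _ LG).1.
- exact: Mrel_dress.
Qed.

Lemma DzEq_undress z F G : DzEq q' z F G ->
  DzEq q z (dress Psi (z - z1) (z1 - cconj z1) F)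
           (sdress Psi (z - z1) (z1 - cconj z1) G).
Proof.
move=> /DzEqP[LF acF LG M]; apply/DzEqP; split.
- by have [[? _ h] _] := bounded_op_dress (z - z1) (z1 - cconj z1); exact: (h _ LF).1.
- exact: ACloc_dress.
- by have [[? _ h] _] := bounded_op_sdress (z - z1) (z1 - cconj z1); exact: (h _ LG).1.
- exact: Mrel_undress MPsi _ _ _ _.
Qed.

Lemma dress_scale c a b F :
  vscale c (dress Psi a b F) = dress Psi (c * a) (c * b) F.
Proof. by apply/funext => x; apply: pair_ext; rewrite /=; ring. Qed.

Lemma sdress_scale c a b F :
  vscale c (sdress Psi a b F) = sdress Psi (c * a) (c * b) F.
Proof. by apply/funext => x; apply: pair_ext; rewrite /=; ring. Qed.

Lemma darboux_similar z : z != z1 -> z != cconj z1 -> similar q q' z.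
Proof.
rewrite -subr_eq0 => n1; rewrite -subr_eq0 => n2.
(* The undressing matrix is [z - conj z1] on the range of [P] and [z - z1] on its kernel, the
   reverse of [T]; their product is the scalar inverted here. *)
pose d := ((z - z1) * (z - cconj z1))^-1.
pose a := z - cconj z1; pose b := cconj z1 - z1.
pose a' := d * (z - z1); pose b' := d * (z1 - cconj z1).
have e1 : a * a' = 1 by rewrite /a /a' /d; field; rewrite n1 n2.
have e2 : a * b' + b * a' + b * b' = 0 by rewrite /a /b /a' /b'; ring.
have e3 : a' * b + b' * a + b' * b = 0 by rewrite -[RHS]e2; ring.
have [k1 k2] := dressK e1 e2.
have [k3 k4] : _ /\ _ := dressK (etrans (mulrC _ _) e1) e3.
exists (dress Psi a b), (sdress Psi a b), (dress Psi a' b'), (sdress Psi a' b').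
split; [split|move=> F G; exact: DzEq_dress| |split=> //].
- exact: bounded_op_dress.
- exact: bounded_op_sdress.
- exact: bounded_op_dress.
- exact: bounded_op_sdress.
- move=> F G /DzEq_undress/(DzEq_scale d).
  by rewrite dress_scale sdress_scale.
Qed.

Lemma ACloc_phi : ACloc (phi Psi).
Proof.
have [k1 k2] := ACloc_vkconj acPsi.
by split; apply: cAC_mul => //; exact: cAC_invdot.
Qed.

Section AtBasePoint.
Hypothesis res : resolvent q z1.
Hypothesis Lphi : L2 (phi Psi).

(* (D(q') - z1) f = g is solved by the projection Pf, which is controlled by the
   resolvent of D(q), a correction v with P v = 0, and a multiple of phi. *)
Lemma base_point_decomposition : exists2 K : R, 0 <= K & forall f g, DzEq q' z1 f g ->
  exists (a : C) (r : vfun R), [/\ L2 r, l2norm r ^+ 2 <= K * l2norm g ^+ 2 &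
    f = vadd r (vscale a (phi Psi))].
Proof.
have [surj [c hc]] := res; set cb := cconj z1.
pose Kk : R := 8 + 2 * (csq (cb - z1) * (4 * c ^+ 2)).
have Kk0 : 0 <= Kk.
  by have := csq_ge0 (cb - z1); have := sqr_ge0 c; rewrite /Kk; nra.
exists (2 * c ^+ 2 + 8 * (c ^+ 2 * Kk)).
  by have := sqr_ge0 c; nra.
move=> f g /DzEqP[Lf acf Lg M].
have sqr_le F G : DzEq q z1 F G -> l2norm F ^+ 2 <= c ^+ 2 * l2norm G ^+ 2.
  move=> /hc le; rewrite -exprMn; have := l2norm_ge0 F; nra.
pose p := vproj Psi f.
have MP : Mrel q p (vadd (vsproj Psi g) (vscale z1 p)).
  apply: Mrel_ext (Mrel_vproj Psi0 MPsi (Mrel_undarboux Psi0 q'E M)) => x.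
  exact: (@project_identity _ (proj (Psi x)) _ (sproj_padd (Psi x)) (sproj_pscale (Psi x))
    z1 cb (f x) (g x) (sproj_idem (f x) (@Psi0 x))).
have [Lp _] := L2_vproj Psi0 acPsi Lf; have acp := ACloc_vproj Psi0 acPsi acf.
have [Lsg lsg] := L2_vsproj Psi0 acPsi Lg.
have Dp : DzEq q z1 p (vsproj Psi g) by apply/DzEqP.
have lp := sqr_le _ _ Dp.
have [Lsp lsp] := L2_vsproj Psi0 acPsi Lp.
pose m F G := vadd (vscale 1 F) (vscale (-1) G).
have mE F G : m F G = vsub F G.
  by apply/funext => x; apply: pair_ext; rewrite /= mul1r mulN1r.
pose k := vadd (vsub g (vsproj Psi g)) (vscale (cb - z1) (vsub (vsproj Psi p) p)).
have [L1 l1] := L2_vsub Lg Lsg; have [L2' l2'] := L2_vsub Lsp Lp.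
have [L3 l3] := l2norm_vscale (cb - z1) L2'.
have [Lk lk0] := L2_vadd L1 L3.
have lk : l2norm k ^+ 2 <= Kk * l2norm g ^+ 2.
  exact: rhs_bound (csq_ge0 _) (sqr_ge0 c) lsg lp lsp l1 l2' (le_trans lk0
    (lerD (lexx _) (ler_wpM2l _ l3))).
have Mu : Mrel q' (m f p) (vadd k (vscale z1 (m f p))).
  apply: Mrel_ext (Mrel_lin 1 (-1) M (Mrel_darboux Psi0 q'E MP)) => x.
  apply: etrans (@complement_identity _ (proj (Psi x)) (sproj (Psi x)) z1 cb (f x) (g x)
    (proj_idem (f x) (@Psi0 x))) _.
  by apply: pair_ext; rewrite /= !mulN1r.
have Sk x : sproj (Psi x) (k x) = (0, 0).
  rewrite (_ : k x = padd (padd (g x) (pscale (-1) (vsproj Psi g x)))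
     (pscale (cb - z1) (padd (vsproj Psi p x) (pscale (-1) (p x))))).
    exact: (@rhs_identity _ _ (sproj_padd (Psi x)) (sproj_pscale (Psi x)) z1 cb (p x) (g x)
      (sproj_idem (p x) (@Psi0 x)) (sproj_idem (g x) (@Psi0 x))).
  by apply: pair_ext; rewrite /= !mulN1r.
(* The resolvent of D(q) is applied to [k], and the complement of the result solves the same
   equation for [q'] as [f - P f]. *)
have [F DF] := surj k Lk; have lF := sqr_le _ _ DF.
have [LF acF _ MF] := (DzEqP _ _ _ _).1 DF.
pose v := m F (vproj Psi F).
have Mv : Mrel q' v (vadd k (vscale z1 v)).
  apply: Mrel_ext (Mrel_darboux Psi0 q'E (Mrel_lin 1 (-1) MF (Mrel_vproj Psi0 MPsi MF))) => x.
  exact: (@corrector_identity _ _ _ (proj_padd (Psi x)) (proj_pscale (Psi x)) (sproj_padd (Psi x))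
    (sproj_pscale (Psi x)) z1 cb (F x) (k x) (proj_idem (F x) (@Psi0 x)) (Sk x)).
have [LPF lPF] := L2_vproj Psi0 acPsi LF.
have [Lv lv] : L2 v /\ l2norm v ^+ 2 <= 2 * l2norm F ^+ 2 + 2 * l2norm (vproj Psi F) ^+ 2.
  by rewrite /v mE; exact: L2_vsub.
have acm F1 G1 : ACloc F1 -> ACloc G1 -> ACloc (m F1 G1).
  by rewrite mE; exact: ACloc_vsub.
(* The difference of the two solutions is homogeneous and killed by [P], hence a multiple of
   [phi]. *)
have [||||a wE] := @Mrel_kernel _ q q' z1 Psi Psi0 q'E MPsi (m (m f p) v).
- exact: acm _ _ (acm _ _ acf acp) (acm _ _ acF (ACloc_vproj Psi0 acPsi acF)).
- exact: acPsi.
- apply: Mrel_ext (Mrel_lin 1 (-1) Mu Mv) => x.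
  by apply: pair_ext; rewrite /=; ring.
- move=> x; have E G : vproj Psi (m G (vproj Psi G)) x = (0, 0).
    rewrite mE vproj_vsub (_ : vproj Psi (vproj Psi G) = vproj Psi G).
      by apply: pair_ext; rewrite /= subrr.
    by apply/funext => y; exact: proj_idem.
  rewrite mE vproj_vsub; apply: pair_ext; rewrite /vsub (E f) (E F) /= subrr//.
have [Lr lr] := L2_vadd Lp Lv.
exists a, (vadd p v); split => //.
  exact: remainder_bound (sqr_ge0 c) lsg lp lPF lF lk lv lr.
apply/funext => x.
rewrite (_ : vscale a (phi Psi) = m (m f p) v); last by apply/funext => y; rewrite wE.
by apply: pair_ext; rewrite /=; ring.
Qed.

End AtBasePoint.
End DarbouxSpectra.

(** * Compactness when solutions are controlled up to multiples of one function *)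

Section RankOnePerturbation.
Variable R : realType.
Local Notation C := R[i].
Implicit Types (q : R -> C) (z : C) (F : vfun R).

(** The remainders [r n] tend to zero with [g n], so only the coefficients [a n] can obstruct
    convergence; they are bounded because [F] is nonzero, and bounded complex numbers have
    convergent subsequences. *)
Lemma rank_one_weyl_compact q z F (K : R) : 0 <= K -> L2 F -> l2norm F != 0 ->
  (forall f g, DzEq q z f g -> exists (a : C) (r : vfun R),
    [/\ L2 r, l2norm r ^+ 2 <= K * l2norm g ^+ 2 & f = vadd r (vscale a F)]) ->
  weyl_compact q z.
Proof.
move=> K0 LF F0 dec f g B Dfg fB g0.
have Lf n : L2 (f n) by have [] := (DzEqP _ _ _ _).1 (Dfg n).
have /choice[ar har] : forall n, exists ar : C * vfun R, [/\ L2 ar.2,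
    l2norm ar.2 ^+ 2 <= K * l2norm (g n) ^+ 2 & f n = vadd ar.2 (vscale ar.1 F)].
  by move=> n; have [a [r h]] := dec _ _ (Dfg n); exists (a, r).
pose a n := (ar n).1; pose r n := (ar n).2.
have Lr n : L2 (r n) by have [] := har n.
have rg n : l2norm (r n) ^+ 2 <= K * l2norm (g n) ^+ 2 by have [] := har n.
have fE n : f n = vadd (r n) (vscale (a n) F) by have [] := har n.
have [M gM] : exists M : R, forall n, l2norm (g n) <= M.
  have [M [_ hM]] : bounded_fun (fun n => l2norm (g n)).
    by apply: cvg_seq_bounded; apply/cvg_ex; exists 0.
  exists (M + 1) => n; apply: le_trans (ler_norm _) _.
  by apply: hM => //; rewrite ltrDl.
have N0 : 0 < l2norm F ^+ 2 by rewrite exprn_gt0// lt_neqAle eq_sym F0 l2norm_ge0.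
(* From [|a|^2 ||F||^2 = ||f - r||^2 <= 2 B^2 + 2 K M^2]. *)
pose A : R := (2 * B ^+ 2 + 2 * (K * M ^+ 2)) / l2norm F ^+ 2.
have aA n : csq (a n) <= A.
  rewrite ler_pdivlMr// -l2norm_vscaleE//.
  have -> : vscale (a n) F = vsub (f n) (r n).
    by apply/funext => x; rewrite fE; apply: pair_ext; rewrite /=; ring.
  apply: le_trans (L2_vsub (Lf n) (Lr n)).2 _; apply: lerD; apply: ler_wpM2l => //.
    by rewrite lerXn2r ?nnegrE ?l2norm_ge0// (le_trans (l2norm_ge0 (f n))).
  apply: le_trans (rg n) _; apply: ler_wpM2l => //.
  by rewrite lerXn2r ?nnegrE ?l2norm_ge0// (le_trans (l2norm_ge0 (g n))).
have sq_bound (u v : R) : u ^+ 2 + v ^+ 2 <= A -> `|u| <= 1 + A.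
  move=> uvA; have := sqr_ge0 v; have := sqr_ge0 (`|u| - 1); rewrite sqrrB mulr1.
  have : `|u| ^+ 2 = u ^+ 2 by rewrite real_normK// num_real.
  rewrite expr1n mulr2n; have := normr_ge0 u; move: uvA; clear; lra.
have [n|phi1 incr1 [l1 c1]] := @bolzano_weierstrass_homo R (fun n => complex.Re (a n)) (1 + A).
  exact: sq_bound (aA n).
(* The imaginary parts are extracted along [phi1], so that the real parts still converge. *)
have [n|phi2 incr2 [l2 c2]] :=
    @bolzano_weierstrass_homo R (fun n => complex.Im (a (phi1 n))) (1 + A).
  by apply: sq_bound; rewrite addrC; exact: aA.
have c1' := cvg_homo incr2 c1.
have incr : {homo phi1 \o phi2 : m n / (m < n)%N >-> (m < n)%N}.
  by move=> m n mn; apply/incr1/incr2.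
exists (phi1 \o phi2); split => //.
exists (vscale (Complex l1 l2) F); split; first exact: (l2norm_vscale _ LF).1.
pose al n := a (phi1 (phi2 n)) - Complex l1 l2.
apply: (@cvg0_squeeze _ _ (fun n =>
  2 * K * l2norm (g ((phi1 \o phi2) n)) ^+ 2 +
  (2 * l2norm F ^+ 2 * complex.Re (al n) ^+ 2 +
   2 * l2norm F ^+ 2 * complex.Im (al n) ^+ 2))).
- by move=> n; exact: l2norm_ge0.
- move=> n; rewrite -mulrDr -/(csq (al n)).
  have -> : vsub (f ((phi1 \o phi2) n)) (vscale (Complex l1 l2) F) =
      vadd (r ((phi1 \o phi2) n)) (vscale (al n) F).
    by apply/funext => x; rewrite fE; apply: pair_ext; rewrite /al /=; ring.
  have [La la] := l2norm_vscale (al n) LF.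
  apply: le_trans (L2_vadd (Lr _) La).2 _.
  apply: lerD; rewrite -mulrA; apply: ler_wpM2l => //.
  by rewrite mulrC.
- rewrite -[0](addr0 0); apply: cvgD.
    have cg := cvg_homo incr g0; have := cvg0_sqr (2 * K) 0 cg cg.
    by under eq_fun do rewrite mul0r addr0.
  apply: cvg0_sqr.
    have -> : (fun n => complex.Re (al n)) = (fun n => complex.Re (a (phi1 (phi2 n))) - l1).
      by apply/funext => n; rewrite /al Re_add Re_opp.
    by rewrite -(subrr l1); apply: cvgB; [exact: c1'|exact: cvg_cst].
  have -> : (fun n => complex.Im (al n)) = (fun n => complex.Im (a (phi1 (phi2 n))) - l2).
    by apply/funext => n; rewrite /al Im_add Im_opp.
  by rewrite -(subrr l2); apply: cvgB; [exact: c2|exact: cvg_cst].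
Qed.

End RankOnePerturbation.

Theorem theorem6p15 (R : realType) (q : R -> R[i]) (z1 : R[i]) (Pm Pp : vfun R) :
  L1loc q ->
  resolvent q z1 ->
  wave q z1 Pm -> wave q z1 Pp ->
  (forall r : R, L2on `]-oo, r] Pm) ->
  (forall r : R, L2on `[r, +oo[ Pp) ->
  spectrum (q1 q z1 Pm Pp) = spectrum q `|` [set z1; cconj z1] /\
  point_spectrum (q1 q z1 Pm Pp) = point_spectrum q `|` [set z1; cconj z1] /\
  ess_spectrum (q1 q z1 Pm Pp) = ess_spectrum q.
Proof.
move=> _ res /waveP[acm [xm Pmx] Mm] /waveP[acp nzp Mp] L2m L2p.
set q' := q1 q z1 Pm Pp.
(* Otherwise [Pm] is a multiple of [Pp], hence square integrable at both ends, and is an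
   eigenfunction at a point of the resolvent set. *)
have W0 : wronskian Pm Pp 0 <> 0.
  move=> /(wronskian_colinear acm acp Mm Mp nzp)[a PmE].
  have Lm : L2 Pm.
    apply: L2_halves => //; rewrite PmE.
    have /vmeas_vscale mp := L2on_vmeas (L2p 0).
    apply: (@L2on_le _ _ (csq a) 0 Pp Pp) => //; first exact: csq_ge0.
    by move=> x _; rewrite mul0r addr0; have := normsq_pscale a (Pp x); rewrite /normsq /vsq /= => ->.
  apply: (point_spectrum_sub _ res); apply/point_spectrumP; exists Pm.
    by apply/DzEq0P.
  exact: ACloc_l2norm_neq0 Pmx.
have Wx x : wronskian Pm Pp x = wronskian Pm Pp 0.
  exact: wronskian_const Mm Mp x 0.
pose Psi := vadd Pm Pp.
have WmE x : (Psi x).1 * (Pp x).2 - (Psi x).2 * (Pp x).1 = wronskian Pm Pp 0.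
  by rewrite -(Wx x) /wronskian /Psi /=; ring.
have WpE x : (Pm x).1 * (Psi x).2 - (Pm x).2 * (Psi x).1 = wronskian Pm Pp 0.
  by rewrite -(Wx x) /wronskian /Psi /=; ring.
have Psi0 x : Psi x <> (0, 0).
  by move=> P0; apply: W0; rewrite -(WmE x) P0 /= !mul0r subrr.
have acPsi : ACloc Psi by exact: ACloc_vadd.
have MPsi : Mrel q Psi (vscale z1 Psi).
  have := Mrel_lin 1 1 Mm Mp.
  rewrite (_ : vadd (vscale 1 Pm) _ = Psi); last first.
    by apply/funext => x; apply: pair_ext; rewrite /= !mul1r.
  by apply: Mrel_ext => x; apply: pair_ext; rewrite /= !mul1r mulrDr.
have q'E x : q' x = q x -
    2 * 'i * (z1 - cconj z1) * (Psi x).1 * cconj (Psi x).2 / dot (Psi x) (Psi x).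
  by rewrite /q' /q1 four_Im -/Psi -(normsqE (Psi x)) /normsq !mulNr.
have Lphi : L2 (phi Psi).
  have vphi x : vsq (phi Psi) x = (normsq (Psi x))^-1.
    have n0 : normsq (Psi x) != 0 by rewrite normsq_eq0; apply/eqP.
    have -> : vsq (phi Psi) x = normsq (pscale (dot (Psi x) (Psi x))^-1 (kconj (Psi x))) by [].
    by rewrite normsq_pscale normsq_kconj csqV -normsqE csq_real; field.
  have cW : 0 < csq (wronskian Pm Pp 0).
    by rewrite lt_neqAle csq_ge0 eq_sym csq_eq0 andbT; apply/eqP.
  have bnd D F : measurable D -> L2on D F ->
      (forall x, csq (wronskian Pm Pp 0) <= normsq (Psi x) * normsq (F x)) -> L2on D (phi Psi).
    move=> mD LF WF; apply: (@L2on_le _ _ (csq (wronskian Pm Pp 0))^-1 0 F F) => //.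
    - by rewrite invr_ge0 csq_ge0.
    - by apply: ACloc_vmeas; exact: ACloc_phi.
    - move=> x _; rewrite mul0r addr0 vphi mulrC ler_pdivlMr// mulrC ler_pdivrMr.
        by rewrite mulrC; exact: WF.
      exact: normsq_gt0.
  apply: L2_halves; first exact: ACloc_phi.
    by apply: bnd (L2m 0) _ => // x; rewrite -(WpE x) [leRHS]mulrC; exact: csq_det_le.
  by apply: bnd (L2p 0) _ => // x; rewrite -(WmE x); exact: csq_det_le.
have phi0 : l2norm (phi Psi) != 0.
  apply: (@ACloc_l2norm_neq0 _ _ 0) => //; first exact: ACloc_phi.
  move=> p0; have /eqP := Psi0 0; rewrite -normsq_eq0 -normsq_kconj => /negP[].
  have d0 : dot (Psi 0) (Psi 0) != 0 by exact: dotPsi0.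
  rewrite normsq_eq0; apply/eqP; move: p0; rewrite /phi => -[e1 e2].
  by apply: pair_ext; apply: (mulfI (x := (dot (Psi 0) (Psi 0))^-1));
    rewrite ?invr_eq0//= ?e1 ?e2 mulr0.
have sp1 : point_spectrum q' z1.
  apply/point_spectrumP; exists (phi Psi) => //; apply/DzEq0P; split => //.
    exact: ACloc_phi.
  exact: Mrel_phi.
have sp2 : point_spectrum q' (cconj z1) by exact: point_spectrum_conj.
have sim z : z <> z1 -> z <> cconj z1 -> similar q q' z.
  by move=> /eqP n1 /eqP n2; exact: (darboux_similar Psi0 acPsi q'E MPsi n1 n2).
have cases z : [set z1; cconj z1] z \/ similar q q' z.
  have [->|n1] := pselect (z = z1); first by left; left.
  have [->|n2] := pselect (z = cconj z1); first by left; right.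
  by right; exact: sim.
have sp_in z : [set z1; cconj z1] z -> point_spectrum q' z by move=> [->|->].
(* Both points lie outside both essential spectra: at [z1] by the resolvent of D(q) and by the
   decomposition along [phi], at [conj z1] by applying K to sequences. *)
have wc : forall z, [set z1; cconj z1] z -> weyl_compact q z /\ weyl_compact q' z.
  have w1 := resolvent_weyl_compact res.
  have [K K0 dec] := base_point_decomposition Psi0 acPsi q'E MPsi res.
  have w2 := rank_one_weyl_compact K0 Lphi phi0 dec.
  by move=> z [->|->]; split => //; exact: weyl_compact_conj.
split; [|split]; apply/seteqP; split => z.
- move=> nres; have [|s] := cases z; first by right.
  by left => res'; apply: nres; exact: similar_resolvent s res'.
- move=> [nres|/sp_in/point_spectrum_sub//].
  have [/sp_in/point_spectrum_sub//|s] := cases z.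
  by move=> res'; apply: nres; exact: similar_resolvent (similar_sym s) res'.
- move=> pscale; have [|s] := cases z; first by right.
  by left; exact: similar_point_spectrum (similar_sym s) pscale.
- move=> [pscale|/sp_in//]; have [/sp_in//|s] := cases z.
  exact: similar_point_spectrum s pscale.
- move=> /ess_spectrumP nw; apply/ess_spectrumP => w; apply: nw.
  have [/wc[]//|s] := cases z; exact: similar_weyl_compact s w.
- move=> /ess_spectrumP nw; apply/ess_spectrumP => w; apply: nw.
  have [/wc[]//|s] := cases z; exact: similar_weyl_compact (similar_sym s) w.
Qed.
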